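(* Let $T>0$ and $n\ge1$ be an integer. Let $\sigma:\mathbb{R}^d\to\mathbb{R}^{d\times d}$ and $b:\mathbb{R}^d\to\mathbb{R}^d$ be Lipschitz continuous with linear growth, let $P_0$ have finite second order moment, and let $X^1,\dots,X^n$ be independent copies, defined on a probability space $(\Omega,\mathcal{F},\mathbb{P})$, of the nonlinear process described in the context, with time marginals $(P_t)_{t\ge0}$, driving white noises $W^1_P,\dots,W^n_P$ and initial conditions $X_0^1,\dots,X_0^n$. Assume that $P_t$ has a density with respect to Lebesgue measure for each $t>0$. For $t\in(0,T]$ and $\omega\in\Omega$, let $T^{t,\omega,n}:\mathbb{R}^d\to\mathbb{R}^d$ be the ($P_t$-a.e. unique) optimal transport map between $P_t$ and $\nu^n_t(\omega)=\frac1n\sum_{i=1}^n\delta_{X^i_t(\omega)}$ for the quadratic cost. Then there exists a process $T^n:[0,T]\times\Omega\times\mathbb{R}^d\to\mathbb{R}^d$, $(t,\omega,x)\mapsto T^n(t,\omega,x)$, measurable with respect to $\mathcal{P}red^n\otimes\mathcal{B}(\mathbb{R}^d)$, such that for $dt\otimes\mathbb{P}(d\omega)$-almost every $(t,\omega)\in[0,T]\times\Omega$, $$T^n(t,\omega,x)=T^{t,\omega,n}(x)\quad\text{for }P_t(dx)\text{-almost every }x .$$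
   Context: White noise: for a measurable family $(P_t)_{t\ge0}$ of probability measures on $\mathbb{R}^d$, an $\mathbb{R}^d$-valued space-time white noise $W_P=(W_P^{(1)},\dots,W_P^{(d)})$ on $[0,\infty)\times\mathbb{R}^d$ with independent coordinates of covariance measure $P_t(dy)\otimes dt$ means: each coordinate is a centered Gaussian family indexed by Borel sets $A\subset[0,\infty)\times\mathbb{R}^d$ of finite $P_t(dy)dt$-measure, with $E(W_P^{(m)}(A)W_P^{(m')}(A'))=\delta_{mm'}\int\!\!\int \mathbf 1_{A\cap A'}(t,y)P_t(dy)dt$. Stochastic integrals are taken in the sense of Walsh. Nonlinear process: $X$ is a continuous $\mathbb{R}^d$-valued process with $$X_t=X_0+\int_0^t\int_{\mathbb{R}^d}\sigma(X_s-y)\,W_P(dy,ds)+\int_0^t\int_{\mathbb{R}^d}b(X_s-y)\,P_s(dy)\,ds,$$ where $P_t$ is the law of $X_t$ and $W_P$ is an $\mathbb{R}^d$-valued space-time white noise on $[0,\infty)\times\mathbb{R}^d$ with independent coordinates of covariance measure $P_t(dy)\otimes dt$, for this family $(P_t)$, independent of $X_0\sim P_0$; under the stated hypotheses it exists and its law is unique. Moreover $E(\sup_{t\in[0,T]}|X_t|^2)<\infty$. Independent copies $X^1,\dots,X^n$ are solutions of this equation (with the same $(P_t)$) driven by independent white noises $W^i_P$, with i.i.d. initial conditions $X_0^i\sim P_0$ independent of the white noises. Filtration: $\mathcal{F}^n_t$ is the complete right-continuous $\sigma$-field generated by $\{(W_P^1([0,s]\times A^1),\dots,W_P^n([0,s]\times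 A^n)):0\le s\le t,\ A^i\in\mathcal{B}(\mathbb{R}^d)\}$ and $(X_0^1,\dots,X_0^n)$. $\mathcal{P}red^n$ is the predictable $\sigma$-field on $[0,T]\times\Omega$ generated by the continuous $(\mathcal{F}^n_t)$-adapted processes. Optimal transport map: when $\mu,\nu$ are probability measures on $\mathbb{R}^d$ with finite second moments and $\mu$ has a density, there is a unique minimizer $\pi$ of $\int|x-y|^2\pi(dx,dy)$ among probability measures on $\mathbb{R}^{2d}$ with marginals $\mu$ and $\nu$, and it has the form $\pi(dx,dy)=\mu(dx)\delta_{S(x)}(dy)$ with $S:\mathbb{R}^d\to\mathbb{R}^d$ measurable and unique $\mu$-a.e. (the Brenier map); $S$ is the optimal transport map between $\mu$ and $\nu$. *)

(* Defs.v *)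
From HB Require Import structures.
From mathcomp Require Import all_boot all_order all_algebra.
From mathcomp Require Import all_classical all_reals all_analysis measurable_realfun lra.

Set Implicit Arguments.
Unset Strict Implicit.
Unset Printing Implicit Defensive.

Import Order.TTheory GRing.Theory Num.Theory.
Import numFieldNormedType.Exports.

Local Open Scope classical_set_scope.
Local Open Scope ring_scope.

(* Matrices over [R], hence the vectors ['rV[R]_d] of R^d, carry the Borel
   sigma-algebra of their topology. *)
HB.instance Definition _ (R : realType) (m n : nat) :=
  @isMeasurable.Build (sigma_display (@open 'M[R]_(m, n))) 'M[R]_(m, n)
    <<s @open 'M[R]_(m, n) >>
    (@sigma_algebra0 _ setT _) (@sigma_algebraC _ _)
    (@sigma_algebra_bigcup _ setT _).

Lemma measurable_mx_ball (R : realType) (d : nat) d1 (T1 : measurableType d1)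
    (f : T1 -> 'rV[R]_d) (q : 'rV[R]_d) (e : R) :
  (forall j, measurable_fun setT (fun x => f x ord0 j)) ->
  measurable (f @^-1` ball q e).
Proof.
move=> mf; have [e0|e0] := ltP 0 e; last first.
  rewrite [X in measurable X](_ : _ = set0)//.
  by apply/seteqP; split=> x //= -[]; rewrite ltNge e0.
rewrite [X in measurable X](_ : _ =
    \big[setI/setT]_(j < d) ((fun x => f x ord0 j) @^-1` ball (q ord0 j) e)).
  apply: bigsetI_measurable => j _; rewrite -[X in measurable X]setTI.
  by apply: mf => //; apply: open_measurable; exact: ball_open.
apply/seteqP; split => x.
  by move=> [_ fx]; apply: (big_ind (fun A : set T1 => A x)) => // j _; exact: fx.
move=> fx; split=> // i j; rewrite (ord1 i).
by move: fx; rewrite (bigD1 j)//= => -[].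
Qed.

Lemma measurable_fun_rV (R : realType) (d : nat) d1 (T1 : measurableType d1)
    (f : T1 -> 'rV[R]_d) :
  (forall j, measurable_fun setT (fun x => f x ord0 j)) ->
  measurable_fun setT f.
Proof.
move=> mf; apply: (@measurability _ _ _ _ _ _ (@open 'rV[R]_d)) => // _ [U oU <-].
rewrite setTI.
pose B (k : 'rV[rat]_d * rat) : set 'rV[R]_d :=
  ball (map_mx (ratr : rat -> R) k.1 : 'rV[R]_d) (ratr k.2).
have -> : U = \bigcup_(k in [set k | B k `<=` U]) B k.
  apply/seteqP; split => [x Ux|x [k kU Bx]]; last exact: kU.
  have [e e0 xeU] : exists2 e : R, 0 < e & ball x e `<=` U.
    by have := oU; rewrite openE => /(_ _ Ux)/nbhs_ballP[e e0 ?]; exists e.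
  have [r] := rat_in_itvoo (divr_gt0 e0 (ltr0n R 2)).
  rewrite in_itv/= => /andP[r0 re].
  have /choice[q qx] (j : 'I_d) : exists p : rat,
      ball (x ord0 j) (ratr r) (ratr p : R).
    have : x ord0 j - ratr r < x ord0 j + ratr r by lra.
    move=> /rat_in_itvoo[p]; rewrite in_itv/= => /andP[p1 p2].
    by exists p; rewrite /ball/= ltr_norml; apply/andP; split; lra.
  have xq : ball (map_mx (ratr : rat -> R) (\row_j q j) : 'rV[R]_d) (ratr r) x.
    by split=> // i j; rewrite !mxE (ord1 i); exact/ball_sym/qx.
  exists (\row_j q j, r) => //= y yq; apply: xeU.
  rewrite (splitr e); apply: (@le_ball _ _ _ (ratr r + ratr r)).
    by rewrite lerD// ltW.
  exact: ball_triangle (ball_sym xq) yq.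
rewrite preimage_bigcup bigcup_mkcond; apply: countable_bigcupT_measurable.
  exact: countableP.
by move=> k; case: ifPn => // _; exact: measurable_mx_ball.
Qed.

Lemma measurable_coord (R : realType) (m n : nat) (i : 'I_m) (j : 'I_n) :
  measurable_fun [set: 'M[R]_(m, n)] (fun M : 'M[R]_(m, n) => M i j).
Proof.
apply: (measurability _ (RGenOpens.measurableE R)) => _ [_ [a [b ->] <-]].
rewrite setTI; apply: sub_sigma_algebra.
move/continuousP: (@coord_continuous R m n i j); apply; exact: interval_open.
Qed.

Definition rV_cons (R : realType) (d : nat) (z : 'rV[R]_d * R) : 'rV[R]_d.+1 :=
  row_mx (const_mx z.2 : 'rV_1) z.1.

Lemma measurable_rV_cons (R : realType) (d : nat) :
  measurable_fun setT (@rV_cons R d).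
Proof.
apply: measurable_fun_rV => j; rewrite /rV_cons.
case: (unliftP ord0 j) => [k|] ->.
  have jk : lift ord0 k = rshift 1 k by exact: val_inj.
  rewrite (_ : (fun x => _) = (fun M : 'rV[R]_d => M ord0 k) \o fst).
    exact: measurableT_comp (measurable_coord _ _) measurable_fst.
  by apply/funext => x; rewrite jk (row_mxEr (const_mx x.2 : 'rV_1) x.1).
have j0 : ord0 = lshift d (ord0 : 'I_1) by exact: val_inj.
rewrite (_ : (fun x => _) = snd); first exact: measurable_snd.
by apply/funext => x; rewrite j0 (row_mxEl (const_mx x.2 : 'rV_1) x.1) mxE.
Qed.

Section lebesgue_rV_succ.
Local Open Scope ereal_scope.
Context (R : realType) (d : nat) (mu : {measure set 'rV[R]_d -> \bar R}).

Definition lebesgue_rV_succ : set 'rV[R]_d.+1 -> \bar R :=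
  pushforward (mu \x lebesgue_measure) (@rV_cons R d).

Let lebesgue_rV_succ0 : lebesgue_rV_succ set0 = 0.
Proof. by rewrite /lebesgue_rV_succ /pushforward preimage_set0 measure0. Qed.

Let lebesgue_rV_succ_ge0 A : 0 <= lebesgue_rV_succ A.
Proof. by rewrite /lebesgue_rV_succ /pushforward measure_ge0. Qed.

Let lebesgue_rV_succ_sigma_additive : semi_sigma_additive lebesgue_rV_succ.
Proof.
apply: (@measure_semi_sigma_additive _ _ _ (pushforward _ _)) => //.
exact: measurable_rV_cons.
Qed.

HB.instance Definition _ := isMeasure.Build _ _ _ lebesgue_rV_succ
  lebesgue_rV_succ0 lebesgue_rV_succ_ge0 lebesgue_rV_succ_sigma_additive.

End lebesgue_rV_succ.

Fixpoint lebesgue_rV (R : realType) (d : nat) :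
    {measure set 'rV[R]_d -> \bar R} :=
  match d with
  | 0 => \d_(0 : 'rV[R]_0)
  | d'.+1 => lebesgue_rV_succ (lebesgue_rV R d')
  end.
Arguments lebesgue_rV : clear implicits.

Lemma lebesgue_rV_box (R : realType) (d : nat) (A : 'I_d -> set R) :
  (forall j, measurable (A j)) ->
  lebesgue_rV R d [set x | forall j, A j (x ord0 j)] =
  (\prod_(j < d) lebesgue_measure (A j))%E.
Proof.
elim: d A => [|d IH] A mA.
  by rewrite big_ord0 /= diracE mem_set// => -[].
rewrite big_ord_recl muleC -IH; last by move=> j; exact: mA.
rewrite /= /lebesgue_rV_succ /pushforward.
have mbox : measurable [set x : 'rV[R]_d | forall j, A (lift ord0 j) (x ord0 j)].
  rewrite [X in measurable X](_ : _ =
      \big[setI/setT]_(j < d)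
        ((fun x : 'rV[R]_d => x ord0 j) @^-1` A (lift ord0 j))); last first.
    apply/seteqP; split => x /= xA.
      by apply: (big_ind (fun B : set 'rV[R]_d => B x)) => // j _; exact: xA.
    by move=> j; move: xA; rewrite (bigD1 j)//= => -[].
  apply: bigsetI_measurable => j _; rewrite -[X in measurable X]setTI.
  by apply: measurable_coord => //; exact: mA.
rewrite -product_measure1E//; last exact: mA.
have jr (j : 'I_d) : lift ord0 j = rshift 1 j by exact: val_inj.
have j0 : ord0 = lshift d (ord0 : 'I_1) by exact: val_inj.
have E0 (x : 'rV[R]_d) (y : R) : rV_cons (x, y) ord0 ord0 = y.
  by rewrite j0 /rV_cons (row_mxEl (const_mx y : 'rV_1) x) mxE.
have Er (x : 'rV[R]_d) (y : R) j : rV_cons (x, y) ord0 (lift ord0 j) = x ord0 j.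
  by rewrite jr /rV_cons (row_mxEr (const_mx y : 'rV_1) x).
congr (_ _); apply/seteqP; split => [[x y] /= xyA|[x y] /= [xA yA] j].
  by split=> [j|]; [rewrite -(Er x y)|rewrite -(E0 x y)]; exact: xyA.
by case: (unliftP ord0 j) => [k|] ->; rewrite ?Er ?E0.
Qed.

Definition has_density (R : realType) (d : nat)
    (mu : {measure set 'rV[R]_d -> \bar R}) : Prop :=
  exists f : 'rV[R]_d -> R,
    [/\ measurable_fun setT f, (forall x, 0 <= f x) &
        forall A, measurable A -> mu A = (\int[lebesgue_rV R d]_(x in A) (f x)%:E)%E].

Definition sqnorm (R : realType) (d : nat) (x : 'rV[R]_d) : R :=
  \sum_(j < d) x ord0 j ^+ 2.

Section optimal_transport.
Local Open Scope ereal_scope.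
Context {R : realType} {d : nat}.
Implicit Types (mu nu : set 'rV[R]_d -> \bar R)
  (pi : probability ('rV[R]_d * 'rV[R]_d)%type R).

Definition transport_plan mu nu pi : Prop :=
  forall A, measurable A -> pi (A `*` setT) = mu A /\ pi (setT `*` A) = nu A.

Definition transport_cost pi : \bar R := \int[pi]_z (sqnorm (z.1 - z.2))%:E.

Definition optimal_plan mu nu pi : Prop :=
  transport_plan mu nu pi /\
  forall pi', transport_plan mu nu pi' -> transport_cost pi <= transport_cost pi'.

(* [pi A = mu {x | (x, S x) \in A}] is pi(dx,dy) = mu(dx) delta_{S(x)}(dy). *)
Definition optimal_transport_map mu nu (S : 'rV[R]_d -> 'rV[R]_d) : Prop :=
  measurable_fun setT S /\
  exists2 pi, optimal_plan mu nu pi &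
    forall A, measurable A -> pi A = mu ((fun x => (x, S x)) @^-1` A).

Definition empirical (n : nat) (x : 'I_n -> 'rV[R]_d) (A : set 'rV[R]_d) :
    \bar R :=
  (n%:R^-1)%:E * \sum_(i < n) \d_(x i) A.

End optimal_transport.

Section white_noise.
Context {d0 : measure_display} {Omega : measurableType d0} {R : realType}.
Variable Pr : probability Omega R.

(* Sigma-algebras on [Omega] are represented by their sets of events. *)
Definition independent_sigma_fields (I : finType)
    (F : I -> set (set Omega)) : Prop :=
  forall E : I -> set Omega, (forall i, F i (E i)) ->
    Pr (\bigcap_i E i) = (\prod_i Pr (E i))%E.

(* The degenerate law N(0,0) is included; [normal_prob 0 s] is N(0,s^2). *)
Definition centered_gaussian (Y : Omega -> R) : Prop :=
  {ae Pr, forall w, Y w = 0} \/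
  exists2 s : R, s != 0 &
    forall B, measurable B -> Pr (Y @^-1` B) = normal_prob 0 s B.

Context {d : nat}.
Variable P : R -> probability 'rV[R]_d R.

Definition covariance_measure (A : set (R * 'rV[R]_d)) : \bar R :=
  (\int[lebesgue_measure]_(t in `[0%R, +oo[) \int[P t]_y (\1_A (t, y))%:E)%E.

Definition noise_set (A : set (R * 'rV[R]_d)) : Prop :=
  [/\ measurable A, A `<=` `[0, +oo[ `*` setT & (covariance_measure A < +oo)%E].

(* A noise is a random set function; its values outside [noise_set] are
   irrelevant. *)
Notation noise := (set (R * 'rV[R]_d) -> Omega -> 'rV[R]_d).

Definition coordinate_sigma_field (W : noise) (m : 'I_d) : set (set Omega) :=
  <<s [set E | exists A B, [/\ noise_set A, measurable B &
         E = (fun w => W A w ord0 m) @^-1` B]] >>.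

Definition noise_sigma_field (W : noise) : set (set Omega) :=
  <<s [set E | exists A B, [/\ noise_set A, measurable B &
         E = W A @^-1` B]] >>.

Record white_noise (W : noise) : Prop := {
  wn_family : forall A, measurable A -> measurable_fun (`[0, +oo[ : set R) (P^~ A);
  wn_measurable : forall A, noise_set A -> measurable_fun setT (W A);
  wn_gaussian : forall (m : 'I_d) (N : nat) (c : 'I_N -> R)
      (A : 'I_N -> set (R * 'rV[R]_d)), (forall j, noise_set (A j)) ->
    centered_gaussian (fun w => \sum_(j < N) c j * W (A j) w ord0 m);
  wn_covariance : forall (m m' : 'I_d) A A', noise_set A -> noise_set A' ->
    ('E_Pr[fun w => (W A w ord0 m * W A' w ord0 m')%R])%E =
    (if m == m' then covariance_measure (A `&` A') else 0%E);
  wn_independent : independent_sigma_fields (coordinate_sigma_field W)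
}.

End white_noise.

Section filtration.
Context {d0 : measure_display} {Omega : measurableType d0} {R : realType}.
Variable Pr : probability Omega R.
Context {d n : nat}.

Definition noise_events (W : 'I_n -> set (R * 'rV[R]_d) -> Omega -> 'rV[R]_d)
    (X0 : 'I_n -> Omega -> 'rV[R]_d) (t : R) : set (set Omega) :=
  [set E | exists i s A B, [/\ 0 <= s <= t, measurable A, measurable B &
     E = W i (`[0, s] `*` A) @^-1` B]] `|`
  [set E | exists i B, measurable B /\ E = X0 i @^-1` B].

(* The null sets of the ambient sigma-algebra, which need not be complete. *)
Definition null_events : set (set Omega) :=
  [set N | measurable N /\ Pr N = 0%E].

(* W i ([0,s] x A) and X0 i generate the raw filtration; it is completed, then
   made right-continuous by intersecting over u > t. *)
Definition noise_filtration
    (W : 'I_n -> set (R * 'rV[R]_d) -> Omega -> 'rV[R]_d)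
    (X0 : 'I_n -> Omega -> 'rV[R]_d) (t : R) : set (set Omega) :=
  \bigcap_(u in [set u | t < u]) <<s noise_events W X0 u `|` null_events >>.

End filtration.

Section processes.
Context {d0 : measure_display} {Omega : measurableType d0} {R : realType}.
Variables (Pr : probability Omega R) (F : R -> set (set Omega)).

Definition adapted d1 (V : measurableType d1) (D : set R) (Y : R -> Omega -> V) :
    Prop :=
  forall t B, D t -> measurable B -> F t (Y t @^-1` B).

(* A sigma-algebra on the set [0,T] x Omega. *)
Definition predictable (T : R) : set (set (R * Omega)) :=
  <<s `[0, T] `*` setT,
    [set E | exists (Y : R -> Omega -> R) (B : set R),
       [/\ forall w, {within `[0, T], continuous (Y^~ w)},
           adapted `[0, T] Y, measurable B &
           E = (`[0, T] `*` setT) `&` [set z | B (Y z.1 z.2)]]] >>.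

(* A sigma-algebra on the set [0,T] x Omega x R^d. *)
Definition predictable_borel (d : nat) (T : R) :
    set (set (R * Omega * 'rV[R]_d)) :=
  <<s (`[0, T] `*` setT) `*` setT,
    [set E | exists A B, [/\ predictable T A, measurable B & E = A `*` B]] >>.

Definition predictable_borel_measurable (d : nat) (T : R)
    (f : R -> Omega -> 'rV[R]_d -> 'rV[R]_d) : Prop :=
  forall B, measurable B ->
    @predictable_borel d T
      (((`[0, T] `*` setT) `*` setT) `&` [set z | B (f z.1.1 z.1.2 z.2)]).

Context {d : nat}.
Variable P : R -> probability 'rV[R]_d R.

(* Data of the elementary function
   (s, w, y) |-> el_coef(w) 1_{]el_lo, el_hi]}(s) 1_{el_set}(y). *)
Record elementary := Elementary {
  el_lo : R;
  el_hi : R;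
  el_set : set 'rV[R]_d;
  el_coef : Omega -> R;
  el_lo_ge0 : 0 <= el_lo;
  el_measurable : measurable el_set;
  el_bounded : exists M, forall w, `|el_coef w| <= M;
  el_adapted : forall B, measurable B -> F el_lo (el_coef @^-1` B)
}.

Definition simple_fun (f : seq elementary) (s : R) (w : Omega) (y : 'rV[R]_d) :
    R :=
  \sum_(e <- f) el_coef e w * \1_(`]el_lo e, el_hi e] `*` el_set e) (s, y).

Definition simple_integral (W : set (R * 'rV[R]_d) -> Omega -> R)
    (t : R) (f : seq elementary) (w : Omega) : R :=
  \sum_(e <- f)
    el_coef e w * W ((`]el_lo e, el_hi e] `&` `[0, t]) `*` el_set e) w.

(* [I] is (a version of) the Walsh integral of [f] over [0,t] x R^d against the
   real-valued noise [W] of covariance measure P_s(dy)ds: the L^2 limit of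
   integrals of simple functions converging to [f] in
   L^2(Pr(dw) P_s(dy) ds). *)
Definition walsh_integral (W : set (R * 'rV[R]_d) -> Omega -> R)
    (t : R) (f : R -> Omega -> 'rV[R]_d -> R) (I : Omega -> R) : Prop :=
  measurable_fun setT I /\
  exists f_ : nat -> seq elementary,
    (fun k => \int[Pr]_w \int[lebesgue_measure]_(s in `[0%R, t])
       \int[P s]_y ((simple_fun (f_ k) s w y - f s w y) ^+ 2)%:E)%E
      @ \oo --> 0%E /\
    (fun k => \int[Pr]_w ((simple_integral W t (f_ k) w - I w) ^+ 2)%:E)%E
      @ \oo --> 0%E.

(* Solutions relative to the filtration [F]. The stochastic term is written
   coordinatewise: its k-th coordinate is the sum over m of the integrals of
   sigma_{km}(X_s - y) against the m-th coordinate of [W]; similarly for the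
   Lebesgue integral of [b]. *)
Record nonlinear_process (sigma : 'rV[R]_d -> 'M[R]_d)
    (b : 'rV[R]_d -> 'rV[R]_d)
    (W : set (R * 'rV[R]_d) -> Omega -> 'rV[R]_d)
    (X : R -> Omega -> 'rV[R]_d) : Prop := {
  np_measurable : forall t : R, 0 <= t -> measurable_fun setT (X t);
  np_continuous : forall w, {within `[0, +oo[, continuous (X^~ w)};
  np_adapted : adapted `[0, +oo[ X;
  np_law : forall (t : R) B, 0 <= t -> measurable B -> Pr (X t @^-1` B) = P t B;
  np_moment : forall T : R, 0 <= T ->
    (\int[Pr]_w ereal_sup [set (sqnorm (X t w))%:E | t in `[0%R, T]] < +oo)%E;
  np_equation : forall (t : R) (k : 'I_d), 0 <= t ->
    exists2 J : 'I_d -> Omega -> R,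
      forall m, walsh_integral (fun A w => W A w ord0 m) t
        (fun s w y => sigma (X s w - y) k m) (J m) &
      {ae Pr, forall w, X t w ord0 k =
         X 0 w ord0 k + \sum_(m < d) J m w +
         \int[lebesgue_measure]_(s in `[0%R, t])
           \int[P s]_y b (X s w - y) ord0 k}
}.

End processes.

(* The norms are the sup norms of the library; the property, like being
   Lipschitz, does not depend on the choice of norms on R^d and R^(d x d). *)
Definition linear_growth (R : realType) (d : nat) (V : normedModType R)
    (f : 'rV[R]_d -> V) : Prop :=
  exists K : R, forall x, `|f x| <= K * (1 + `|x|).

(* Main.v *)
Require Import Defs.
From HB Require Import structures.
From mathcomp Require Import all_boot all_order all_algebra.
From mathcomp Require Import all_classical all_reals all_analysis measurable_realfun ring lra.

Set Implicit Arguments.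
Unset Strict Implicit.
Unset Printing Implicit Defensive.

Import Order.TTheory GRing.Theory Num.Theory.
Import numFieldNormedType.Exports.

Local Open Scope classical_set_scope.
Local Open Scope ring_scope.

(** The target measure is finitely supported, so optimal transport is
semi-discrete and is governed by finitely many real numbers. For atoms
y_1, ..., y_n and a vector of potentials w, the Laguerre cell of y_i is the set
of points x at which |x - y_i|^2 - w_i is minimal.

For one measure mu with a density and a finite second moment:
- two cells overlap in a subset of a hyperplane, which is mu-null
  ([lebesgue_rV_hyperplane], [ae_unique_cell]);
- some w makes the mass of every cell equal to the weight of its atom
  ([exists_potentials]): w maximizes the Kantorovich dual functional, and the
  weights can be read off from the first variation at a maximum;
- any optimal map sends the cell of y_i to y_i almost everywhere
  ([optimal_map_on_cells]): the map which does so is an admissible competitor,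
  and comparing costs forces equality in the inequalities which define the
  cells. In particular the optimal map is unique.

It remains to choose the cells measurably in a parameter theta, here (t, omega).
The exact potentials are not unique, and choosing them measurably would need a
selection theorem. Instead, for each k one takes the first vector of rational
potentials, in a fixed enumeration, whose cells have the right masses up to an
error of order 2^-k; this choice is a countable case distinction on measurable
functions of theta. Comparing the two families of inequalities which define the
approximate and the exact cells shows that the total gap left by the k-th choice
has integral O(2^-k). These gaps are thus summable almost everywhere, they tend
to 0, and almost every x eventually stays in its exact cell
([stable_cells]). Sending x to the atom whose approximate cells contain it
infinitely often is therefore jointly measurable in (theta, x), and it is almost
everywhere equal to every optimal map ([measurable_selection],
[selection_optimal]).

Finally, the parameter space is [0, T] x Omega with the predictable
sigma-algebra, for which time and the continuous adapted processes X^i are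
measurable. The time t = 0, where no density is assumed, forms a null set. *)

(** * Real-valued integration *)

Section measurability.
Context d (T : measurableType d).

Lemma measurable_fun_forall (I : finType) (f : I -> T -> bool) :
  (forall i, measurable_fun setT (f i)) ->
  measurable_fun setT (fun x => [forall i, f i x]).
Proof.
move=> mf; rewrite (_ : (fun x => _) = fun x => all (f ^~ x) (enum I)); last first.
  apply/funext => x; apply/forallP/allP => [h i _|h i]; first exact: h.
  by apply: h; rewrite mem_enum.
elim: (enum I) => [|i s IH] /=; first exact: measurable_cst.
exact: measurable_and.
Qed.

Lemma measurable_fun_implyb (f g : T -> bool) : measurable_fun setT f ->
  measurable_fun setT g -> measurable_fun setT (fun x => f x ==> g x).
Proof.
move=> mf mg; under eq_fun do rewrite implybE.
by apply: measurable_or => //; exact: measurableT_comp.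
Qed.

Lemma measurable_set_bool (f : T -> bool) :
  measurable_fun setT f -> measurable [set x | f x].
Proof.
by move=> /(_ measurableT [set true]); rewrite setTI; exact.
Qed.

End measurability.

Section real_integrable.
Context d (T : measurableType d) (R : realType).
Variable mu : {measure set T -> \bar R}.
Local Notation integr f := (mu.-integrable setT (EFin \o f)).

Lemma integrable_RB (f g : T -> R) :
  integr f -> integr g -> integr (fun x => f x - g x).
Proof. by move=> fi gi; have := integrableB measurableT fi gi. Qed.

Lemma integrable_RD (f g : T -> R) :
  integr f -> integr g -> integr (fun x => f x + g x).
Proof. by move=> fi gi; have := integrableD measurableT fi gi. Qed.

Lemma integrable_RZ (a : R) (f : T -> R) :
  integr f -> integr (fun x => a * f x).
Proof. by move=> fi; have := integrableZl measurableT a fi. Qed.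

Lemma measurable_Rint (f : T -> R) : integr f -> measurable_fun setT f.
Proof. by move=> fi; apply/measurable_EFinP; exact: (measurable_int _ fi). Qed.

Lemma ae_le_Rintegral (f g : T -> R) : integr f -> integr g ->
  {ae mu, forall x, f x <= g x} -> \int[mu]_x f x <= \int[mu]_x g x.
Proof.
move=> fi gi fg; have gfi := integrable_RB gi fi.
rewrite -subr_ge0 -RintegralB//.
rewrite /Rintegral (@ae_eq_integral _ _ _ mu setT (fun x => `|g x - f x|%:E))//.
- exact/fine_ge0/integral_ge0.
- exact: (measurable_int _ gfi).
- by apply/measurable_EFinP/measurableT_comp => //; exact: measurable_Rint gfi.
- by apply: filterS fg => x fgx _ /=; rewrite ger0_norm// subr_ge0.
Qed.

Lemma integrable_Rsum (I : Type) (s : seq I) (f : I -> T -> R) :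
  (forall i, integr (f i)) -> integr (fun x => \sum_(i <- s) f i x).
Proof.
move=> fi; rewrite [EFin \o _](_ : _ = fun x => (\sum_(i <- s) (f i x)%:E)%E).
  by apply: integrable_sum => // i _; exact: fi.
by apply/funext => x /=; rewrite sumEFin.
Qed.

Lemma Rintegral_sum (I : Type) (s : seq I) (f : I -> T -> R) :
  (forall i, integr (f i)) ->
  \int[mu]_x (\sum_(i <- s) f i x) = \sum_(i <- s) \int[mu]_x f i x.
Proof.
move=> fi; elim: s => [|i s IH].
  under eq_Rintegral do rewrite big_nil.
  by rewrite big_nil /Rintegral integral0.
under eq_Rintegral do rewrite big_cons.
by rewrite big_cons RintegralD// ?IH//; exact: integrable_Rsum.
Qed.

End real_integrable.

(** The series of the integrals converges, so the series of the functions has a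
finite integral and is finite almost everywhere; its terms then tend to 0. *)
Lemma ae_cvg0_summable d (T : measurableType d) (R : realType)
    (mu : {measure set T -> \bar R}) (f : nat -> T -> R) (C : R) :
  0 <= C ->
  (forall k, mu.-integrable setT (EFin \o f k)) ->
  (forall k, {ae mu, forall x, 0 <= f k x}) ->
  (forall k, \int[mu]_x f k x <= C / (2 ^ k.+1)%:R) ->
  {ae mu, forall x, f ^~ x @ \oo --> 0}.
Proof.
move=> C0 fi f0 fC; pose S x := (\sum_(k <oo) `|f k x|%:E)%E.
have mf k : measurable_fun setT (fun x => `|f k x|%:E).
  by apply/measurable_EFinP/measurableT_comp => //; exact: measurable_Rint (fi k).
have S0 x : (0 <= S x)%E by apply: nneseries_ge0 => k _ _; rewrite lee_fin.
have Si : mu.-integrable setT S.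
  apply/integrableP; split.
    by apply: ge0_emeasurable_sum => // k x _ _; rewrite lee_fin.
  under eq_integral do rewrite gee0_abs//.
  rewrite integral_nneseries//; apply: le_lt_trans (ltry C).
  apply: le_trans (epsilon_trick0 xpredT C0); apply: lee_nneseries => // k _.
    by move=> _; apply: integral_ge0 => x _; rewrite lee_fin.
  apply: (@le_trans _ _ (\int[mu]_x f k x)%:E); last by rewrite lee_fin.
  rewrite /Rintegral fineK; last exact: integrable_fin_num (fi k).
  rewrite le_eqVlt; apply/orP; left; apply/eqP; apply: ae_eq_integral => //.
    exact: (measurable_int _ (fi k)).
  by apply: filterS (f0 k) => x fx _ /=; rewrite ger0_norm.
apply: filterS (integrable_ae measurableT Si) => x /(_ Logic.I) Sx.
apply/norm_cvg0P.
have Soo : (S x < +oo)%E by rewrite ltey_eq Sx.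
have tail : (\sum_(N <= k <oo) `|f k x|%:E @[N --> \oo] --> 0)%E.
  by apply: nneseries_tail_cvg => // k _; rewrite lee_fin.
have /fine_cvgP[_] : (`|f N x|%:E @[N --> \oo] --> 0)%E; last by [].
apply: squeeze_cvge (cvg_cst 0%E) tail; near=> N; rewrite lee_fin normr_ge0/=.
rewrite (le_trans _ (@nneseries_lim_ge _ _ xpredT N N.+1 _))//.
by rewrite big_nat1.
Unshelve. all: by end_near. Qed.

Section step.
Context d (T : measurableType d) (R : realType).
Variable mu : probability T R.

Let bool_indic (b : T -> bool) :
  (fun x => (b x)%:R : R) = \1_[set x | b x].
Proof. by apply/funext => x; rewrite indicE mem_setE. Qed.

Lemma integrable_bool (b : T -> bool) : measurable_fun setT b ->
  mu.-integrable setT (EFin \o (fun x => (b x)%:R)).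
Proof.
move=> mb; rewrite bool_indic; apply: integrable_indic => //.
exact: measurable_set_bool.
Qed.

Lemma Rintegral_bool (b : T -> bool) : measurable_fun setT b ->
  \int[mu]_x (b x)%:R = fine (mu [set x | b x]).
Proof.
move=> /measurable_set_bool mb; rewrite bool_indic /Rintegral.
by rewrite integral_indic// setIT.
Qed.

Lemma integrable_step (I : finType) (a : I -> R) (b : I -> T -> bool) :
  (forall i, measurable_fun setT (b i)) ->
  mu.-integrable setT (EFin \o (fun x => \sum_i a i * (b i x)%:R)).
Proof.
by move=> mb; apply: integrable_Rsum => i; exact/integrable_RZ/integrable_bool.
Qed.

Lemma Rintegral_step (I : finType) (a : I -> R) (b : I -> T -> bool) :
  (forall i, measurable_fun setT (b i)) ->
  \int[mu]_x (\sum_i a i * (b i x)%:R) = \sum_i a i * fine (mu [set x | b i x]).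
Proof.
move=> mb; rewrite Rintegral_sum; last first.
  by move=> i; exact/integrable_RZ/integrable_bool.
apply: eq_bigr => i _; rewrite RintegralZl ?Rintegral_bool//.
exact: integrable_bool.
Qed.

Lemma integrable_Rcst (a : R) : mu.-integrable setT (EFin \o (fun=> a)).
Proof. exact: finite_measure_integrable_cst. Qed.

Lemma Rintegral_Rcst (a : R) : \int[mu]_x a = a.
Proof. by rewrite Rintegral_cst//= [mu _]probability_setT mulr1. Qed.

End step.

(** * Laguerre cells *)

Section laguerre.
Context d (T : measurableType d) (R : realType) (n : nat).
Implicit Types (c : 'I_n -> T -> R) (p w v : 'I_n -> R).

(** The Laguerre cell of index i, when h = 0. A positive slack h enlarges it; the
variation of the dual functional and the perturbation of w are both controlled
by the mass gained in this way. Indices of zero weight are discarded altogether,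
so that an atom listed several times can be counted once. *)
Definition cell c p w (h : R) (i : 'I_n) (x : T) : bool :=
  (0 < p i) && [forall j, (0 < p j) ==> (c i x - w i <= c j x - w j + h)].

Lemma measurable_cell c p w h i : (forall j, measurable_fun setT (c j)) ->
  measurable_fun setT (cell c p w h i).
Proof.
move=> mc; apply: measurable_and => //; apply: measurable_fun_forall => j.
apply: measurable_fun_implyb => //; apply: measurable_fun_ler.
  exact: measurable_funB.
by apply: measurable_funD => //; exact: measurable_funB.
Qed.

Lemma cellP c p w h i x :
  reflect (0 < p i /\ forall j, 0 < p j -> c i x - w i <= c j x - w j + h)
          (cell c p w h i x).
Proof.
apply: (iffP andP) => -[pi ci]; split=> //.
  by move=> j pj; move: ci => /forallP/(_ j); rewrite pj.
by apply/forallP => j; apply/implyP => /ci.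
Qed.

Lemma exists_cell c p w x : (exists i, 0 < p i) -> exists i, cell c p w 0 i x.
Proof.
move=> [i0 pi0].
have [i pi ci] := @Order.TotalTheory.arg_minP _ _ _ i0
  (fun i => 0 < p i) (fun i => c i x - w i) pi0.
by exists i; apply/cellP; split=> // j pj; rewrite addr0; exact: ci.
Qed.

Variable mu : probability T R.
Variables (c : 'I_n -> T -> R) (p : 'I_n -> R).
Hypothesis mc : forall i, measurable_fun setT (c i).
Hypothesis p_pos : exists i, 0 < p i.
Hypothesis no_ties : forall i j, 0 < p i -> 0 < p j -> i != j ->
  forall s, mu [set x | c i x - c j x = s] = 0%E.

(** A point lying in two cells satisfies c i x - c j x = w i - w j, a null event. *)
Lemma ae_unique_cell w :
  {ae mu, forall x, exists i, forall j, cell c p w 0 j x = (j == i)}.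
Proof.
have : {ae mu, forall x, forall ij : 'I_n * 'I_n,
    0 < p ij.1 -> 0 < p ij.2 -> ij.1 != ij.2 ->
    c ij.1 x - c ij.2 x != w ij.1 - w ij.2}.
  apply: filter_forall => -[i j] /=.
  have [/and3P[pi pj ij]|nP] := boolP [&& 0 < p i, 0 < p j & i != j]; last first.
    apply: (@filterS _ _ _ setT) => [x _ pi pj ij|]; last exact: filterT.
    by case/negP: nP; rewrite pi pj ij.
  exists [set x | c i x - c j x = w i - w j]; split.
  - have := measurable_fun_eqr (measurable_funB (mc i) (mc j))
      (@measurable_cst _ _ _ _ setT (w i - w j)).
    move=> /measurable_set_bool; congr measurable.
    by apply/seteqP; split => x /= /eqP.
  - exact: no_ties.
  - by move=> x /= /not_implyP[_] /not_implyP[_] /not_implyP[_] /negP; rewrite negbK => /eqP.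
apply: filterS => x tie.
have [i xi] := exists_cell c w x p_pos.
exists i => j; apply/idP/eqP => [xj|->//]; apply/eqP/negPn/negP => ji.
move: xi xj => /cellP[pi ci] /cellP[pj cj].
have /= := tie (j, i) pj pi ji.
move: (ci _ pj) (cj _ pi); rewrite !addr0 => h1 h2 /eqP; apply.
lra.
Qed.

Lemma measurable_set_cell w h i : measurable [set x | cell c p w h i x].
Proof. exact/measurable_set_bool/measurable_cell. Qed.

Definition cellmass w h i : R := fine (mu [set x | cell c p w h i x]).

Lemma cellmassE w h i :
  (cellmass w h i)%:E = mu [set x | cell c p w h i x].
Proof. by rewrite fineK// fin_num_measure//; exact: measurable_set_cell. Qed.

Lemma sum_cellmass w : \sum_i cellmass w 0 i = 1.
Proof.
have mcell i := measurable_cell p w 0 i mc.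
have sE x : \sum_i (cell c p w 0 i x)%:R = \sum_i 1 * (cell c p w 0 i x)%:R :> R.
  by apply: eq_bigr => i _; rewrite mul1r.
rewrite -[RHS](Rintegral_Rcst mu) -[LHS](eq_bigr _ (fun i _ => mul1r _)).
rewrite -(Rintegral_step mu (fun=> 1) mcell).
have ae1 : {ae mu, forall x, \sum_i 1 * (cell c p w 0 i x)%:R = 1 :> R}.
  apply: filterS (ae_unique_cell w) => x [i xi].
  rewrite (bigD1 i)//= xi eqxx mulr1 big1 ?addr0// => j ji.
  by rewrite xi (negbTE ji) mulr0.
by apply/eqP; rewrite eq_le; apply/andP; split;
  (apply: ae_le_Rintegral; [..|by apply: filterS ae1 => x ->]);
  rewrite ?integrable_Rcst//; exact: integrable_step.
Qed.

Lemma sub_cellmass w w' h h' i : 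
  (forall j, `|w j - w' j| <= h' ) ->
  cellmass w h i <= cellmass w' (h + h' *+ 2) i.
Proof.
move=> ww'; rewrite -lee_fin !cellmassE; apply: le_measure;
  rewrite ?inE; [exact: measurable_set_cell..|].
move=> x /= /cellP[pi xi]; apply/cellP; split=> // j pj.
move: (xi j pj) (ww' i) (ww' j); rewrite !ler_norml => + /andP[? ?] /andP[? ?].
rewrite mulr2n; lra.
Qed.

Lemma cellmass_ge0 w h i : 0 <= cellmass w h i.
Proof. by rewrite -lee_fin cellmassE. Qed.

(** The enlarged cells decrease to the cell as the slack tends to 0. *)
Lemma cellmass_slack w i (e : R) : 0 < e ->
  exists2 h : R, 0 < h & cellmass w h i < cellmass w 0 i + e.
Proof.
move=> e0; pose F k := [set x | cell c p w k.+1%:R^-1 i x].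
have capF : \bigcap_k F k = [set x | cell c p w 0 i x].
  apply/seteqP; split=> x /=.
    move=> xi; apply/cellP; split; first by have /cellP[] := xi 0%N Logic.I.
    move=> j pj; rewrite addr0; apply/ler_addgt0Pr => e' e'0.
    have [k ke] := ltr_add_invr e'0.
    have /cellP[_ /(_ j pj)] := xi k Logic.I.
    by move=> /le_trans; apply; rewrite lerD2l -[leLHS]add0r ltW.
  move=> xi k _; apply/cellP; move/cellP: xi => [pi xi]; split=> // j pj.
  by rewrite (le_trans (xi j pj))// lerD2l.
have : mu \o F @ \oo --> mu [set x | cell c p w 0 i x].
  rewrite -capF; apply: nonincreasing_cvg_mu.
  - by rewrite ltey_eq fin_num_measure//; exact: measurable_set_cell.
  - by move=> k; exact: measurable_set_cell.
  - by rewrite capF; exact: measurable_set_cell.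
  - apply/nonincreasing_seqP => k; apply/subsetPset => x /= /cellP[pi xi].
    apply/cellP; split=> // j pj; rewrite (le_trans (xi j pj))// lerD2l.
    by rewrite lef_pV2 ?posrE// ler_nat.
rewrite -cellmassE => /fine_cvgP[_ /cvgrPdist_lt/(_ _ e0)[k _ /(_ k (leqnn k))/=]].
move=> ke; exists k.+1%:R^-1 => //.
by move: ke; rewrite -/(cellmass _ _ _) ltr_distlC => /andP[_].
Qed.

(** Only an upper bound of the masses needs an argument: for q close to w each
cell of q lies in a slightly enlarged cell of w. The lower bounds follow because
the masses add up to 1 on both sides. *)
Lemma rational_balanced w (e : R) : 0 < e ->
  (forall i, cellmass w 0 i = p i) ->
  exists q : {ffun 'I_n -> rat}, forall i,
    `|cellmass (fun j => ratr (q j)) 0 i - p i| * (1 + `|ratr (q i) : R|) <= e.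
Proof.
move=> e0 wp; pose B := 2 + \sum_j `|w j|.
have B0 : 0 < B by rewrite ltr_wpDr// sumr_ge0.
pose e' := e / (B * n.+1%:R).
have e'0 : 0 < e' by rewrite divr_gt0// mulr_gt0.
have /choice[h hP] i : exists h : R, 0 < h /\ cellmass w h i < p i + e'.
  by have [h h0] := cellmass_slack w i e'0; rewrite wp => hi; exists h.
have /choice[q qP] i : exists q : rat,
    `|ratr q - w i| <= 1 /\ forall j, `|ratr q - w i| <= h j / 2.
  pose m := \big[Num.min/1]_j (h j / 2).
  have m0 : 0 < m by apply/bigmin_gtP; split=> // j _; rewrite divr_gt0//; case: (hP j).
  have /rat_in_itvoo[q] : w i - m < w i + m by lra.
  rewrite in_itv/= -ltr_distlC distrC => qi; exists q; split=> [|j].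
    by rewrite (le_trans (ltW qi))// bigmin_le_id.
  by rewrite (le_trans (ltW qi))// bigmin_le_cond.
exists [ffun i => q i] => i.
have qE : (fun j => ratr ([ffun i => q i] j) : R) = fun j => ratr (q j).
  by apply/funext => j; rewrite ffunE.
rewrite qE ffunE; set v := fun j => _.
have vle j : cellmass v 0 j <= p j + e'.
  apply: le_trans (ltW (hP j).2).
  have -> : h j = 0 + (h j / 2) *+ 2 by rewrite add0r mulr2n -splitr.
  by apply: sub_cellmass => k; exact: (qP k).2.
have p1 : \sum_j p j = 1.
  by rewrite -(sum_cellmass w); apply: eq_bigr => j _.
have vi : `|cellmass v 0 i - p i| <= n.+1%:R * e'.
  have := sum_cellmass v; have := p1; rewrite (bigD1 i)//= [in X in _ -> X](bigD1 i)//=.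
  have : \sum_(j < n | j != i) cellmass v 0 j <=
         \sum_(j < n | j != i) p j + n.+1%:R * e'.
    apply: (@le_trans _ _ (\sum_(j < n | j != i) (p j + e'))).
      by apply: ler_sum => j _; exact: vle.
    rewrite big_split/= lerD2l sumr_const -[leLHS]mulr_natl ler_pM2r// ler_nat.
    by rewrite (leq_trans (max_card _))// card_ord.
  have : e' <= n.+1%:R * e' by rewrite ler_peMl// ?ler1n// ltW.
  by move: (vle i) => ? ? ? ? ?; rewrite ler_norml; apply/andP; split; lra.
have wi : `|w i| <= \sum_j `|w j|.
  by rewrite (bigD1 i)//= lerDl sumr_ge0.
have qi : 1 + `|ratr (q i)| <= B :> R.
  have := ler_normD (ratr (q i) - w i) (w i); rewrite subrK => h1.
  by move: (qP i).1 wi h1; rewrite /B; lra.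
rewrite (le_trans (ler_pM _ _ vi qi))// ?addr_ge0//.
rewrite le_eqVlt; apply/orP; left; apply/eqP; rewrite /e'; field.
by rewrite nat1r pnatr_eq0/= gt_eqF.
Qed.

(** Let x lie in the cell i for w and in the cell j for v k. Adding the
inequalities which define these two cells gives
  0 <= (c j x - w j) - (c i x - w i) <= (v k j - w j) - (v k i - w i).
The right-hand side, as a function of x, is a step function with integral
sum_l (v k l - w l) (mass of the cell l for v k - p l), which the hypothesis
makes O(2^-k); the weight 1 + |v k i| in the hypothesis compensates for the
absence of any bound on v k. So the middle term tends to 0 for almost every x,
and as it takes finitely many values at x, of which only j = i gives 0, it
vanishes eventually. *)
Lemma stable_cells w (v : nat -> 'I_n -> R) :
  (forall i, cellmass w 0 i = p i) ->
  (forall k i, `|cellmass (v k) 0 i - p i| * (1 + `|v k i|) <=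
     (2 ^ k.+1)%:R^-1) ->
  {ae mu, forall x, \forall k \near \oo, forall i,
     cell c p (v k) 0 i x -> cell c p w 0 i x}.
Proof.
move=> wp vp; pose B i := 1 + `|w i|.
have B0 i : 1 <= B i by rewrite lerDl.
pose f k x : R := \sum_i (v k i - w i) * (cell c p (v k) 0 i x)%:R -
                  \sum_i (v k i - w i) * (cell c p w 0 i x)%:R.
have mcell u i := measurable_cell p u 0 i mc.
(* f k is the upper bound of the gap, written as a combination of indicators. *)
have gap : {ae mu, forall x k, exists i j,
    [/\ forall l, cell c p w 0 l x = (l == i),
        forall l, cell c p (v k) 0 l x = (l == j) &
        f k x = (v k j - w j) - (v k i - w i)]}.
  apply: ae_foralln => k; near=> x.
  have : exists i, forall l, cell c p w 0 l x = (l == i).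
    by near: x; exact: ae_unique_cell.
  have : exists i, forall l, cell c p (v k) 0 l x = (l == i).
    by near: x; exact: ae_unique_cell.
  move=> [j xj] [i xi]; exists i, j; split=> //; rewrite /f; congr (_ - _).
    rewrite (bigD1 j)//= xj eqxx mulr1 big1 ?addr0// => l /negbTE lj.
    by rewrite xj lj mulr0.
  rewrite (bigD1 i)//= xi eqxx mulr1 big1 ?addr0// => l /negbTE lj.
  by rewrite xi lj mulr0.
have gap_ge x k i j : (forall l, cell c p w 0 l x = (l == i)) ->
    (forall l, cell c p (v k) 0 l x = (l == j)) ->
    (c j x - w j) - (c i x - w i) <= (v k j - w j) - (v k i - w i) /\
    0 <= (c j x - w j) - (c i x - w i).
  move=> /(_ i) + /(_ j); rewrite !eqxx => /cellP[pi xi] /cellP[pj xj].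
  by move: (xi j pj) (xj i pi); rewrite !addr0 => *; split; lra.
have : {ae mu, forall x, f ^~ x @ \oo --> 0}.
  apply: (@ae_cvg0_summable _ _ _ mu f (\sum_i B i)).
  - by apply: sumr_ge0 => i _; rewrite (le_trans _ (B0 i)).
  - by move=> k; apply: integrable_RB; exact: integrable_step.
  - move=> k; apply: filterS gap => x /(_ k)[i [j [xi xj ->]]].
    by have [+ h] := gap_ge _ _ _ _ xi xj; exact: le_trans.
  - move=> k; rewrite RintegralB//; [|exact: integrable_step..].
    rewrite !Rintegral_step// -sumrB mulr_suml; apply: ler_sum => i _.
    rewrite -/(cellmass _ _ _) -/(cellmass _ _ _) wp -mulrBr.
    have := vp k i; set a := cellmass _ _ _ - _ => ha.
    apply: (le_trans (ler_norm _)); rewrite normrM.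
    apply: (@le_trans _ _ (B i * ((1 + `|v k i|) * `|a|))); last first.
      by rewrite ler_wpM2l// ?(le_trans _ (B0 i))// mulrC.
    rewrite mulrA ler_wpM2r// (le_trans (ler_normB _ _))//.
    rewrite /B mulrDl mul1r mulrDr mulr1.
    have : 0 <= `|w i| * `|v k i| by rewrite mulr_ge0.
    lra.
apply: filterS2 gap => x gap cvgf.
have [i0 [_ [xi0 _ _]]] := gap 0%N.
pose g j := (c j x - w j) - (c i0 x - w i0).
(* m is the least gap between the best index i0 and the other ones at x. *)
pose m := \big[Num.min/1]_(j | (j != i0) && (0 < p j)) g j.
have m0 : 0 < m.
  apply/bigmin_gtP; split=> // j /andP[ji pj]; rewrite lt_neqAle; apply/andP; split.
    apply: contra ji => /eqP gj0; rewrite -xi0; apply/cellP; split=> // l pl.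
    have := xi0 i0; rewrite eqxx => /cellP[_ /(_ l pl)].
    by move: gj0; rewrite /g; lra.
  have := xi0 i0; rewrite eqxx => /cellP[_ /(_ j pj)].
  by rewrite /g addr0 subr_ge0.
move/cvgr0Pnorm_lt : cvgf => /(_ _ m0); apply: filterS => k fk i.
have [i1 [j [xi1 xj fE]]] := gap k.
have i01 : i1 = i0 by apply/eqP; rewrite -xi0 xi1.
rewrite xj xi0 => /eqP ->; apply: contraLR (fk) => ji.
rewrite -leNgt (le_trans _ (ler_norm _))//.
have [+ _] := gap_ge _ _ _ _ xi1 xj; rewrite -fE; apply: le_trans.
rewrite i01 /m -/(g j); apply: bigmin_le_cond; rewrite ji/=.
by have := xj j; rewrite eqxx => /cellP[].
Unshelve. all: by end_near. Qed.

End laguerre.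

(** * Kantorovich potentials *)

Lemma measurable_bigmin d (T : measurableType d) (R : realType) (I : Type)
    (s : seq I) (P : pred I) (f0 : T -> R) (f : I -> T -> R) :
  measurable_fun setT f0 -> (forall i, measurable_fun setT (f i)) ->
  measurable_fun setT (fun x => \big[Num.min/f0 x]_(i <- s | P i) f i x).
Proof.
move=> mf0 mf; elim: s => [|i s IH]; first by under eq_fun do rewrite big_nil.
under eq_fun do rewrite big_cons.
by case: (P i) => //; exact: measurable_minr.
Qed.

Section kantorovich.
Context d (T : measurableType d) (R : realType) (n : nat).
Variables (mu : probability T R) (c : 'I_n -> T -> R) (p : 'I_n -> R).
Hypothesis ci : forall i, mu.-integrable setT (EFin \o c i).
Hypothesis p_ge0 : forall i, 0 <= p i.
Hypothesis p_sum1 : \sum_i p i = 1.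
Hypothesis no_ties : forall i j, 0 < p i -> 0 < p j -> i != j ->
  forall s, mu [set x | c i x - c j x = s] = 0%E.

Let mc i : measurable_fun setT (c i).
Proof. exact: measurable_Rint (ci i). Qed.

Let p_pos : exists i, 0 < p i.
Proof.
apply: contrapT => /forallNP p0; have := oner_neq0 R.
rewrite -p_sum1 big1 ?eqxx// => i _; apply/eqP/negPn/negP => pi0.
by apply: (p0 i); rewrite lt_neqAle eq_sym pi0/=.
Qed.

Let i0 : 'I_n := projT1 (cid p_pos).
Let pi0 : 0 < p i0. Proof. exact: (projT2 (cid p_pos)). Qed.

(** The index i0 only makes the minimum range over a nonempty family. *)
Definition cost_min (w : 'I_n -> R) (x : T) : R :=
  \big[Num.min/c i0 x - w i0]_(j | 0 < p j) (c j x - w j).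

Let cost_min_le w x j : 0 < p j -> cost_min w x <= c j x - w j.
Proof. by move=> pj; apply: bigmin_le_cond. Qed.

Let cost_minE w x : exists i, 0 < p i /\ cost_min w x = c i x - w i.
Proof.
have [i /cellP[pi xi]] := exists_cell c w x p_pos.
exists i; split=> //; apply/eqP; rewrite eq_le cost_min_le//=.
by apply/bigmin_geP; split=> [|j pj]; rewrite -[leRHS]addr0; exact: xi.
Qed.

Let cost_min_int w : mu.-integrable setT (EFin \o cost_min w).
Proof.
apply: (@le_integrable _ _ _ mu _ measurableT _
  (EFin \o (fun x => \sum_j `|c j x - w j|))).
- apply/measurable_EFinP; apply: measurable_bigmin => [|j];
    exact: measurable_funB.
- move=> x _ /=; rewrite lee_fin [leRHS]ger0_norm ?sumr_ge0//.
  have [i [_ ->]] := cost_minE w x.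
  by rewrite (bigD1 i)//= lerDl sumr_ge0.
- apply: integrable_Rsum => j.
  have := integrable_abse (integrable_RB (ci j) (integrable_Rcst mu (w j))).
  by [].
Qed.

(** The Kantorovich dual functional of the semi-discrete transport problem. *)
Definition dual (w : 'I_n -> R) : R :=
  \int[mu]_x cost_min w x + \sum_i p i * w i.

Let le_int_cost_min w w' a : (forall x, cost_min w x <= cost_min w' x + a) ->
  \int[mu]_x cost_min w x <= \int[mu]_x cost_min w' x + a.
Proof.
move=> ww'; rewrite -[X in _ + X](Rintegral_Rcst mu) -RintegralD//; last first.
  exact: integrable_Rcst.
by apply: le_Rintegral => //; apply: integrable_RD => //; exact: integrable_Rcst.
Qed.

Let dual_lip w w' e : (forall i, `|w i - w' i| <= e) -> dual w <= dual w' + e *+ 2.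
Proof.
move=> ww'; rewrite /dual mulr2n addrACA; apply: lerD.
  apply: le_int_cost_min => x; have [i [pi ->]] := cost_minE w' x.
  apply: le_trans (cost_min_le w x pi) _.
  by move: (ww' i); rewrite ler_norml => /andP[? ?]; lra.
rewrite -[X in _ + X]mul1r -p_sum1 mulr_suml -big_split/=.
apply: ler_sum => i _; rewrite -mulrDr ler_wpM2l//.
by move: (ww' i); rewrite ler_norml => /andP[? ?]; lra.
Qed.

Let dual_continuous : continuous (fun u : 'rV[R]_n => dual (u ord0)).
Proof.
move=> u; have FF := nbhs_filter u; apply/cvgrPdist_le => e e0.
have e2 : 0 < e / 2 by rewrite divr_gt0.
have := nbhsx_ballx u (e / 2) e2; apply: filterS => v [_ uv] /=.
have eE : e = e / 2 *+ 2 by rewrite mulr2n -splitr.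
have uvi i : `|u ord0 i - v ord0 i| <= e / 2 by apply: ltW; exact: uv.
have h1 := dual_lip uvi.
have h2 : dual (v ord0) <= dual (u ord0) + e / 2 *+ 2.
  by apply: dual_lip => i; rewrite distrC.
by rewrite ler_norml; apply/andP; split; move: h1 h2; rewrite -eE; lra.
Qed.

Let dual_normalize w (a : R) (w' := fun i => if 0 < p i then w i - a else 0) :
  dual w <= dual w'.
Proof.
rewrite /dual.
have -> : \sum_i p i * w i = a + \sum_i p i * w' i.
  rewrite -[a in RHS]mul1r -p_sum1 mulr_suml -big_split/=; apply: eq_bigr => i _.
  rewrite /w'; case: ltP => [_|pi]; first by rewrite /= -mulrDr subrKC.
  have -> : p i = 0 by apply: le_anti; rewrite pi p_ge0.
  by rewrite !mul0r addr0.
rewrite addrA lerD2r -lerBrDr; apply: le_int_cost_min => x.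
have [i [pi ->]] := cost_minE w' x; apply: le_trans (cost_min_le w x pi) _.
by rewrite /w' pi; lra.
Qed.

(** Adding a constant to w does not change the dual functional, so one may
normalize the largest potential to 0. Then the functional is bounded above by a
constant plus p j * w j for every j, hence is at most its value at 0 outside a
box, and a maximum over the compact box is global. *)
Lemma dual_maximizer : exists w, forall w', dual w' <= dual w.
Proof.
pose I := \sum_i `|\int[mu]_x c i x|.
(* A potential below - M makes the dual functional smaller than its value at 0. *)
pose M := \sum_j (I + `|dual (fun=> 0)|) / p j.
have I0 : 0 <= I by exact: sumr_ge0.
have M0 j : 0 <= (I + `|dual (fun=> 0)|) / p j.
  by rewrite divr_ge0// addr_ge0.
have Mge0 : 0 <= M by exact: sumr_ge0.
pose A := [set u : 'rV[R]_n | forall i, `[- M, 0]%classic (u ord0 i)].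
have A0 : A 0 by move=> i; rewrite /= mxE in_itv/= lexx oppr_le0 Mge0.
have cA : compact A.
  by apply: (@rV_compact _ _ (fun=> `[- M, 0]%classic)) => i; exact: segment_compact.
have [|u uA umax] := compact_EVT_max (ex_intro _ _ A0) cA (f := fun u : 'rV[R]_n => dual (u ord0)).
  by apply: continuous_subspaceT => v; exact: dual_continuous.
exists (u ord0) => w.
have [i1 pi1 i1max] := @Order.TotalTheory.arg_maxP _ _ _ i0
  (fun i => 0 < p i) (fun i => w i) pi0.
apply: le_trans (dual_normalize w (w i1)) _; set w' := fun i => _.
have w'0 i : w' i <= 0.
  by rewrite /w'; case: ifPn => // pi; rewrite subr_le0; exact: i1max.
have [w'A|/existsNP[j w'j]] := pselect (forall i, - M <= w' i).
  have -> : w' = (\row_i w' i) ord0 by apply/funext => i; rewrite mxE.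
  by apply: umax; rewrite inE => i; rewrite /= mxE in_itv/= w'A w'0.
have {}w'j : w' j < - M by rewrite ltNge; exact/negP.
have pj : 0 < p j.
  move: w'j; rewrite /w'; case: ifPn => // _.
  by rewrite ltNge oppr_le0 Mge0.
have d0 : dual (fun=> 0) <= dual (u ord0).
  have -> : (fun=> 0) = (0 : 'rV[R]_n) ord0 by apply/funext => i; rewrite mxE.
  by apply: umax; rewrite inE.
apply: le_trans d0; rewrite /dual.
have h1 : \int[mu]_x cost_min w' x <= I.
  apply: (@le_trans _ _ (\int[mu]_x c i1 x)); last first.
    by rewrite (le_trans (ler_norm _))// /I (bigD1 i1)//= lerDl sumr_ge0.
  apply: le_Rintegral => // x _; apply: le_trans (cost_min_le w' x pi1) _.
  by rewrite /w' pi1 subrr subr0.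
have h2 : \sum_i p i * w' i <= p j * w' j.
  rewrite (bigD1 j)//= gerDl; apply: sumr_le0 => i _.
  by rewrite mulr_ge0_le0.
have h3 : p j * w' j <= - (I + `|dual (fun=> 0)|).
  rewrite mulrC -ler_pdivlMr// mulNr; apply: (le_trans (ltW w'j)).
  by rewrite lerN2 /M (bigD1 j)//= lerDl sumr_ge0.
have := ler_norm (- dual (fun=> 0)); rewrite normrN => h4.
apply: (@le_trans _ _ (- `|dual (fun=> 0)|)); first by lra.
by rewrite -/(dual (fun=> 0)) lerNl; exact: h4.
Qed.

(** Raising the potential w i by h changes the dual functional by p i * h minus at
most h times the mass of the cell i with slack h. At a maximum this yields
p i <= that mass, and p i <= mass of the cell i when h tends to 0. Both sides add
up to 1, so the inequalities are equalities. *)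
Lemma exists_potentials : exists w, forall i, cellmass mu c p w 0 i = p i.
Proof.
have [w wmax] := dual_maximizer; exists w.
have mcell h i := measurable_cell p w h i mc.
have slack h i : 0 < h -> 0 < p i -> p i <= cellmass mu c p w h i.
  move=> h0 pi; pose w' j := w j + h * (j == i)%:R.
  have w'i : w' i = w i + h by rewrite /w' eqxx mulr1.
  have w'j j : j != i -> w' j = w j by move=> /negbTE ji; rewrite /w' ji mulr0 addr0.
  have int_cell : mu.-integrable setT (EFin \o (fun x => h * (cell c p w h i x)%:R)).
    exact/integrable_RZ/integrable_bool.
  have h1 : \int[mu]_x cost_min w x - h * cellmass mu c p w h i <=
            \int[mu]_x cost_min w' x.
    rewrite /cellmass -Rintegral_bool// -RintegralZl//; last exact: integrable_bool.
    rewrite -RintegralB//; apply: le_Rintegral => //; first exact: integrable_RB.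
    move=> x _; have [j [pj ->]] := cost_minE w' x.
    have [->|ji] := eqVneq j i; last first.
      rewrite w'j// lerBlDr (le_trans (cost_min_le w x pj))// lerDl.
      by rewrite mulr_ge0// ltW.
    rewrite w'i; have [xi|/cellP] := boolP (cell c p w h i x).
      by have := cost_min_le w x pi; rewrite mulr1; lra.
    move=> /not_andP[//|/existsNP[l /not_implyP[pl /negP]]]; rewrite -ltNge => xl.
    by rewrite mulr0 subr0 (le_trans (cost_min_le w x pl))//; lra.
  have h2 : \sum_j p j * w' j = \sum_j p j * w j + p i * h.
    rewrite (bigD1 i)//= [in RHS](bigD1 i)//= w'i mulrDr addrAC; congr (_ + _ + _).
    by apply: eq_bigr => j ji; rewrite w'j.
  move: (wmax w'); rewrite /dual h2 => h3.
  by rewrite -(ler_pM2r h0) [leRHS]mulrC; move: h1 h3; lra.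
have ple i : p i <= cellmass mu c p w 0 i.
  have [pi|pi] := ltP 0 (p i); last exact: le_trans pi (cellmass_ge0 _ _ _ _ _ _).
  apply/ler_addgt0Pr => e e0.
  have [h h0 /ltW] := cellmass_slack mu p mc w i e0.
  exact: le_trans (slack h i h0 pi).
move=> i; apply/esym/eqP; rewrite -subr_eq0 -oppr_eq0 opprB.
have /psumr_eq0P : \sum_i (cellmass mu c p w 0 i - p i) = 0.
  by rewrite sumrB (sum_cellmass mc p_pos no_ties) p_sum1 subrr.
by move=> -> // j _; rewrite subr_ge0.
Qed.

End kantorovich.

(** * Absolute continuity rules out ties *)

Section euclidean.
Context (R : realType).

Definition dotp d (a x : 'rV[R]_d) : R := \sum_j a ord0 j * x ord0 j.

Lemma measurable_dotp d (a : 'rV[R]_d) : measurable_fun setT (dotp a).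
Proof.
by apply: measurable_sum => j; apply: measurable_funM => //; exact: measurable_coord.
Qed.

Lemma measurable_hyperplane d (a : 'rV[R]_d) s : measurable [set x | dotp a x = s].
Proof. by have := measurable_dotp a measurableT (measurable_set1 s); rewrite setTI. Qed.

Lemma dotp_cons d (a : 'rV[R]_d.+1) x y :
  dotp a (rV_cons (x, y)) =
  a ord0 ord0 * y + dotp (\row_j a ord0 (lift ord0 j)) x.
Proof.
rewrite /dotp big_ord_recl /rV_cons; congr (_ * _ + _).
  have -> : ord0 = lshift d (ord0 : 'I_1) by exact: val_inj.
  by rewrite (row_mxEl (const_mx y : 'rV_1) x) mxE.
apply: eq_bigr => j _; rewrite mxE.
have -> : lift ord0 j = rshift 1 j by exact: val_inj.
by rewrite (row_mxEr (const_mx y : 'rV_1) x).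
Qed.

(** Slicing along the first coordinate: either every slice is a single point, or
the slices are empty outside a hyperplane of smaller dimension. *)
Lemma lebesgue_rV_hyperplane d (a : 'rV[R]_d) s : a != 0 ->
  lebesgue_rV R d [set x | dotp a x = s] = 0%E.
Proof.
elim: d => [|d IH] in a s *; first by rewrite thinmx0 eqxx.
move=> a0; pose a' := \row_j a ord0 (lift ord0 j).
have mA : measurable ((@rV_cons R d) @^-1` [set x | dotp a x = s]).
  rewrite -[X in measurable X]setTI.
  by apply: measurable_rV_cons => //; exact: measurable_hyperplane.
rewrite /= /lebesgue_rV_succ /pushforward /product_measure1.
have [a00|a00] := eqVneq (a ord0 ord0) 0.
  have a'0 : a' != 0.
    apply: contra a0 => /eqP /rowP a'0; apply/eqP/rowP => j; rewrite mxE.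
    case: (unliftP ord0 j) => [k|] -> //.
    by have := a'0 k; rewrite !mxE.
  rewrite (@ae_eq_integral _ _ _ (lebesgue_rV R d) setT (cst 0%E)) ?integral0//.
    exact: measurable_fun_xsection.
  exists [set x | dotp a' x = s]; split.
  - exact: measurable_hyperplane.
  - exact: IH.
  - move=> x /= /not_implyP[_]; apply: contra_notP => xs.
    rewrite [xsection _ _](_ : _ = set0) ?measure0//.
    apply/seteqP; split => y //=; rewrite /xsection/= inE/= dotp_cons a00 mul0r add0r.
    exact: xs.
rewrite integral0_eq// => x _ /=.
rewrite [xsection _ _](_ : _ = [set (s - dotp a' x) / a ord0 ord0]).
  exact: lebesgue_measure_set1.
apply/seteqP; split => y /=; rewrite /xsection/= inE/= dotp_cons -/a'.
  by move=> <-; rewrite addrK mulrC mulKf.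
by move=> ->; rewrite mulrC divfK// subrK.
Qed.

Lemma sqnormB d (x y : 'rV[R]_d) :
  sqnorm (x - y) = sqnorm x + dotp (- 2 *: y) x + sqnorm y.
Proof.
rewrite /sqnorm /dotp -!big_split/=; apply: eq_bigr => j _.
by rewrite !mxE; ring.
Qed.

(** The difference of two squared distances is affine and not constant, so its
level sets are hyperplanes. *)
Lemma density_no_ties d (mu : probability 'rV[R]_d R) (x y : 'rV[R]_d) s :
  has_density mu -> x != y ->
  mu [set z | sqnorm (z - x) - sqnorm (z - y) = s] = 0%E.
Proof.
move=> [f [mf f0 muE]] xy.
rewrite [X in mu X](_ : _ =
    [set z | dotp (2 *: (y - x)) z = s - sqnorm x + sqnorm y]); last first.
  have E z : dotp (2 *: (y - x)) z =
     sqnorm (z - x) - sqnorm (z - y) - sqnorm x + sqnorm y.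
    rewrite !sqnormB; have -> : dotp (2 *: (y - x)) z = dotp (- 2 *: x) z - dotp (- 2 *: y) z.
      rewrite /dotp -sumrB; apply: eq_bigr => j _; rewrite !mxE; ring.
    ring.
  by apply/seteqP; split => z /=; rewrite E; [move=> ->|lra].
rewrite muE; last exact: measurable_hyperplane.
apply: null_set_integral; [exact: measurable_hyperplane| |].
- by apply/measurable_EFinP; exact: measurable_funTS.
- apply: lebesgue_rV_hyperplane; rewrite scaler_eq0 negb_or pnatr_eq0/= subr_eq0.
  by rewrite eq_sym.
Qed.

Lemma measurable_sqnorm d : measurable_fun setT (@sqnorm R d).
Proof.
by apply: measurable_sum => j; apply: measurable_funX; exact: measurable_coord.
Qed.

Lemma measurable_rV_sub d d1 (T : measurableType d1) (f g : T -> 'rV[R]_d) :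
  measurable_fun setT f -> measurable_fun setT g ->
  measurable_fun setT (fun x => f x - g x).
Proof.
move=> mf mg; apply: measurable_fun_rV => j; under eq_fun do rewrite !mxE.
by apply: measurable_funB; apply: (measurableT_comp (measurable_coord ord0 j)).
Qed.

Lemma measurable_sqdist d d1 (T : measurableType d1) (f g : T -> 'rV[R]_d) :
  measurable_fun setT f -> measurable_fun setT g ->
  measurable_fun setT (fun x => sqnorm (f x - g x)).
Proof.
move=> mf mg; apply: (measurableT_comp (@measurable_sqnorm d)).
exact: measurable_rV_sub.
Qed.

Lemma sqnorm_ge0 d (x : 'rV[R]_d) : 0 <= sqnorm x.
Proof. by apply: sumr_ge0 => j _; exact: sqr_ge0. Qed.

Lemma sqnorm_eq0 d (x : 'rV[R]_d) : (sqnorm x == 0) = (x == 0).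
Proof.
apply/eqP/eqP => [/psumr_eq0P x0|->]; last first.
  by rewrite /sqnorm big1// => j _; rewrite mxE expr0n.
apply/rowP => j; rewrite mxE; apply/eqP; rewrite -sqrf_eq0; apply/eqP.
by apply: x0 => // i _; exact: sqr_ge0.
Qed.

Lemma integrable_sqdist d (mu : probability 'rV[R]_d R) y :
  (\int[mu]_x (sqnorm x)%:E < +oo)%E ->
  mu.-integrable setT (EFin \o (fun x => sqnorm (x - y))).
Proof.
move=> mu2; have sq : mu.-integrable setT (EFin \o @sqnorm R d).
  apply/integrableP; split; first by apply/measurable_EFinP; exact: measurable_sqnorm.
  rewrite (eq_integral (fun x => (sqnorm x)%:E))// => x _.
  by rewrite /= ger0_norm// sqnorm_ge0.
apply: (@le_integrable _ _ _ mu _ measurableT _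
  (EFin \o (fun x => 2 * sqnorm x + 2 * sqnorm y))).
- by apply/measurable_EFinP; exact: measurable_sqdist.
- move=> x _ /=; rewrite lee_fin !ger0_norm ?addr_ge0 ?mulr_ge0 ?sqnorm_ge0//.
  rewrite /sqnorm !mulr_sumr -big_split/=; apply: ler_sum => j _.
  rewrite !mxE; have := sqr_ge0 (x ord0 j + y ord0 j).
  by rewrite !expr2; lra.
- by apply: integrable_RD; [exact: integrable_RZ|exact: integrable_Rcst].
Qed.

End euclidean.

(** * Optimal maps onto finitely many atoms *)

Section atoms.
Context (R : realType) (V : eqType) (n : nat) (y : 'I_n -> V).
Hypothesis n_gt0 : (0 < n)%N.

Definition first_occurrence (i : 'I_n) : bool :=
  [forall j : 'I_n, (j < i)%N ==> (y j != y i)].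

(** The mass of the atom y i in the empirical measure, carried by the first index
at which this atom is listed; repetitions of an atom get the weight 0. *)
Definition atom_weight (i : 'I_n) : R :=
  (first_occurrence i)%:R * (n%:R^-1 * \sum_j (y j == y i)%:R).

Lemma atom_weight_ge0 i : 0 <= atom_weight i.
Proof. by rewrite !mulr_ge0// ?invr_ge0// sumr_ge0. Qed.

Lemma atom_weight_gt0 i : (0 < atom_weight i) = first_occurrence i.
Proof.
rewrite /atom_weight; case: first_occurrence; last by rewrite mul0r ltxx.
rewrite mul1r mulr_gt0// ?invr_gt0 ?ltr0n//.
by rewrite (bigD1 i)//= eqxx ltr_pwDl// sumr_ge0.
Qed.

Lemma atom_weight_inj i j :
  0 < atom_weight i -> 0 < atom_weight j -> y i = y j -> i = j.
Proof.
rewrite !atom_weight_gt0 => /forallP fi /forallP fj yij; apply/val_inj/eqP.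
have := fi j; have := fj i; rewrite yij eqxx !implybF -!leqNgt => ji ij.
by rewrite eqn_leq ij ji.
Qed.

Lemma atom_weight_exists j : exists2 i, 0 < atom_weight i & y i = y j.
Proof.
have [i /eqP yij imin] := @arg_minnP _ j (fun i => y i == y j) val (eqxx _).
exists i => //; rewrite atom_weight_gt0; apply/forallP => k; apply/implyP => ki.
by apply/negP => /eqP yki; have := imin k; rewrite yki yij eqxx leqNgt ki => /(_ isT).
Qed.

(** Each j is accounted for by exactly one first occurrence, that of y j. *)
Lemma sum_atom_weight (F : V -> R) :
  \sum_i F (y i) * atom_weight i = n%:R^-1 * \sum_j F (y j).
Proof.
transitivity (\sum_i \sum_j
    n%:R^-1 * ((first_occurrence i && (y j == y i))%:R * F (y j))).
  apply: eq_bigr => i _; rewrite -mulr_sumr /atom_weight.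
  have -> : F (y i) * ((first_occurrence i)%:R * (n%:R^-1 * \sum_j (y j == y i)%:R)) =
      n%:R^-1 * ((first_occurrence i)%:R * F (y i) * \sum_j (y j == y i)%:R) by ring.
  congr (_ * _); rewrite mulr_sumr; apply: eq_bigr => j _.
  have [->|] := eqVneq (y j) (y i); last by rewrite andbF mulr0 mul0r.
  by rewrite andbT mulr1.
rewrite exchange_big/= mulr_sumr; apply: eq_bigr => j _.
have [r r0 yr] := atom_weight_exists j.
rewrite (bigD1 r)//= -atom_weight_gt0 r0 yr eqxx/= mul1r.
rewrite big1 ?addr0// => i ir; rewrite -atom_weight_gt0.
case: (boolP (_ && _)) => [/andP[pi /eqP ji]|_]; last by rewrite mul0r mulr0.
by case/eqP: ir; apply: atom_weight_inj => //; rewrite yr.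
Qed.

Lemma sum_atom_weight1 : \sum_i atom_weight i = 1.
Proof.
have := sum_atom_weight (fun=> 1); under eq_bigr do rewrite mul1r.
move=> ->; rewrite sumr_const card_ord -[X in _ * X]mulr_natl mulr1 mulVf//.
by rewrite pnatr_eq0 -lt0n.
Qed.

End atoms.

Section piecewise.
Context d (T : measurableType d) d' (V : measurableType d') (I : Type).

Definition first_match (b : I -> T -> bool) (f : I -> T -> V) (v : V)
    (s : seq I) (x : T) : V :=
  foldr (fun i g => if b i x then f i x else g) v s.

Lemma measurable_first_match b f v s :
  (forall i, measurable_fun setT (b i)) ->
  (forall i, measurable_fun setT (f i)) ->
  measurable_fun setT (first_match b f v s).
Proof.
move=> mb mf; elim: s => [|i s IH]; first exact: measurable_cst.
exact: measurable_fun_ifT.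
Qed.

End piecewise.

Lemma first_matchE d (T : measurableType d) d' (V : measurableType d')
    (I : eqType) (b : I -> T -> bool) (f : I -> T -> V) v s x i :
  i \in s -> b i x -> (forall j, b j x -> j = i) ->
  first_match b f v s x = f i x.
Proof.
move=> + bi bx; elim: s => // j s IH; rewrite inE /= => /predU1P[<-|/IH ->].
  by rewrite bi.
by case: ifPn => // /bx ->.
Qed.

Lemma first_match_in d (T : measurableType d) d' (V : measurableType d')
    (I : eqType) (b : I -> T -> bool) (f : I -> T -> V) v s x :
  first_match b f v s x = v \/ exists i, first_match b f v s x = f i x.
Proof.
elim: s => [|j s IH] /=; first by left.
by case: ifP => // _; right; exists j.
Qed.

Lemma ae_eq0_Rintegral d (T : measurableType d) (R : realType)
    (mu : {measure set T -> \bar R}) (f : T -> R) :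
  mu.-integrable setT (EFin \o f) -> {ae mu, forall x, 0 <= f x} ->
  \int[mu]_x f x <= 0 -> {ae mu, forall x, f x = 0}.
Proof.
move=> fi f0 If0; have mf := measurable_Rint fi.
have : ae_eq mu setT (EFin \o f) (cst 0%E).
  apply/ae_eq_integral_abs => //; first exact/measurable_EFinP.
  transitivity (\int[mu]_x (EFin \o f) x)%E.
    apply: ae_eq_integral => //.
    - by apply: measurableT_comp => //; exact/measurable_EFinP.
    - exact/measurable_EFinP.
    - by apply: filterS f0 => x fx _ /=; rewrite ger0_norm.
  apply/eqP; rewrite eq_le; apply/andP; split.
    by rewrite -[leLHS]fineK ?lee_fin//; exact: integrable_fin_num fi.
  rewrite -[leRHS]fineK ?lee_fin; last exact: integrable_fin_num fi.
  have := @ae_le_Rintegral _ _ _ mu (fun=> 0) f (integrable0 mu setT) fi f0.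
  by rewrite /Rintegral integral0.
by apply: filterS => x /(_ Logic.I) [].
Qed.

Section transport_to_atoms.
Local Open Scope ereal_scope.
Context (R : realType) (d : nat).

Lemma measurable_fun_eq_rV d1 (T1 : measurableType d1) (f g : T1 -> 'rV[R]_d) :
  measurable_fun setT f -> measurable_fun setT g ->
  measurable_fun setT (fun x => f x == g x).
Proof.
move=> mf mg; under eq_fun do rewrite -subr_eq0 -sqnorm_eq0.
by apply: measurable_fun_eqr => //; exact: measurable_sqdist.
Qed.

Lemma exists_graph_plan (mu : probability 'rV[R]_d R) (S : 'rV[R]_d -> 'rV[R]_d) :
  measurable_fun setT S ->
  exists pi : probability ('rV[R]_d * 'rV[R]_d)%type R,
    (forall A, measurable A -> pi A = mu ((fun x => (x, S x)) @^-1` A)) /\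
    transport_cost pi = \int[mu]_x (sqnorm (x - S x)%R)%:E.
Proof.
move=> mS.
have mG : measurable_fun setT (fun x => (x, S x)) by exact: measurable_fun_pair.
pose G : {mfun 'rV[R]_d >-> ('rV[R]_d * 'rV[R]_d)%type} :=
  HB.pack (fun x => (x, S x)) (isMeasurableFun.Build _ _ _ _ _ mG).
exists (distribution mu G); split; first by [].
rewrite /transport_cost ge0_integral_pushforward//.
  apply/measurable_EFinP; apply: measurable_sqdist => //.
by move=> z _; rewrite lee_fin sqnorm_ge0.
Qed.

Lemma transport_cost_graph (mu : probability 'rV[R]_d R)
    (S : 'rV[R]_d -> 'rV[R]_d) (pi : probability ('rV[R]_d * 'rV[R]_d)%type R) :
  measurable_fun setT S ->
  (forall A, measurable A -> pi A = mu ((fun x => (x, S x)) @^-1` A)) ->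
  transport_cost pi = \int[mu]_x (sqnorm (x - S x)%R)%:E.
Proof.
move=> mS piE; have [pi' [pi'E <-]] := exists_graph_plan mu mS.
rewrite /transport_cost; apply: eq_measure_integral => A mA _.
exact: etrans (piE A mA) (esym (pi'E A mA)).
Qed.

End transport_to_atoms.

Definition atom_cost (R : realType) (d n : nat) (y : 'I_n -> 'rV[R]_d)
  (i : 'I_n) (x : 'rV[R]_d) : R := sqnorm (x - y i).

Section optimal_map_on_cells.
Context (R : realType) (d n : nat).
Variables (mu : probability 'rV[R]_d R) (y : 'I_n -> 'rV[R]_d).
Hypothesis n_gt0 : (0 < n)%N.
Hypothesis mu_density : has_density mu.
Hypothesis mu_moment : (\int[mu]_x (sqnorm x)%:E < +oo)%E.

Local Notation c := (atom_cost y).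
Local Notation p := (atom_weight R y).

Let ci i : mu.-integrable setT (EFin \o c i).
Proof. exact: integrable_sqdist. Qed.

Let mc i : measurable_fun setT (c i).
Proof. exact: measurable_Rint (ci i). Qed.

Lemma atoms_no_ties i j : 0 < p i -> 0 < p j -> i != j ->
  forall s, mu [set x | c i x - c j x = s] = 0%E.
Proof.
move=> pi pj ij s; apply: density_no_ties => //.
by apply: contra ij => /eqP /(atom_weight_inj n_gt0 pi pj) /eqP.
Qed.

Lemma atoms_p_pos : exists i, 0 < p i.
Proof. by have [i pi _] := atom_weight_exists R y n_gt0 (Ordinal n_gt0); exists i. Qed.

Lemma empiricalE (A : set 'rV[R]_d) :
  empirical y A = (\sum_i (`[< A (y i) >])%:R * p i)%:E.
Proof.
rewrite (sum_atom_weight y n_gt0 (fun z => (`[< A z >])%:R)) EFinM; congr (_ * _)%E.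
rewrite -sumEFin; apply: eq_bigr => i _; by rewrite diracE.
Qed.

(** Let T send the cell i to the atom y i; it transports mu to the empirical
measure because the masses of the cells are the weights, so S does not cost more
than T. Let psi be the function with value w i at y i. As S and T have the same
image measure, psi o S and psi o T have the same integral, hence
|x - S x|^2 - psi (S x) has an integral at most that of |x - T x|^2 - psi (T x).
But the latter is the pointwise minimum, so the two agree almost everywhere,
which puts x in the cell of S x. *)
Lemma optimal_map_on_cells (w : 'I_n -> R) (S : 'rV[R]_d -> 'rV[R]_d) :
  (forall i, cellmass mu c p w 0 i = p i) ->
  optimal_transport_map mu (empirical y) S ->
  {ae mu, forall x, forall i, cell c p w 0 i x -> S x = y i}.
Proof.
move=> wp [mS [pi [piplan pimin] piE]].
have mcell i := measurable_cell p w 0 i mc.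
have uniq := ae_unique_cell mc atoms_p_pos atoms_no_ties w.
pose T := first_match (cell c p w 0) (fun i => cst (y i)) (y (Ordinal n_gt0))
  (enum 'I_n) : 'rV[R]_d -> 'rV[R]_d.
have mT : measurable_fun setT T by apply: measurable_first_match.
have Tin x : exists i, T x = y i.
  by have [Tx|] := first_match_in (cell c p w 0) (fun i => cst (y i))
    (y (Ordinal n_gt0)) (enum 'I_n) x; first by exists (Ordinal n_gt0).
have TE x i : (forall j, cell c p w 0 j x = (j == i)) -> T x = y i.
  move=> xi; rewrite /T (@first_matchE _ _ _ _ _ _ _ _ _ _ i) ?mem_enum ?xi//.
  by move=> j; rewrite xi => /eqP.
have muS A : measurable A -> mu (S @^-1` A) = empirical y A.
  move=> mA; rewrite -(piplan _ mA).2 piE; last exact: measurableX.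
  by congr (mu _); apply/seteqP; split => x //= -[].
have muT A : measurable A -> mu (T @^-1` A) = empirical y A.
  move=> mA; pose b x := `[< A (T x) >].
  have mTA : measurable (T @^-1` A) by rewrite -[X in measurable X]setTI; exact: mT.
  have bE : T @^-1` A = [set x | b x] by apply/seteqP; split=> x /= /asboolP.
  have mb : measurable_fun setT b.
    by apply: (measurable_fun_bool true); rewrite setTI -[X in measurable X]bE.
  rewrite bE -[LHS]fineK; last by rewrite fin_num_measure// -bE.
  rewrite -Rintegral_bool// empiricalE; congr EFin.
  under eq_bigr do rewrite -wp; rewrite -Rintegral_step//.
  have ib := integrable_bool mu mb.
  have ist := integrable_step mu (fun i => (`[< A (y i) >])%:R) mcell.
  have ae1 : {ae mu, forall x, (b x)%:R =
      \sum_i (`[< A (y i) >])%:R * (cell c p w 0 i x)%:R :> R}.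
    apply: filterS uniq => x [i xi]; rewrite /b (TE _ _ xi) (bigD1 i)//= xi eqxx mulr1.
    by rewrite big1 ?addr0// => j /negbTE ji; rewrite xi ji mulr0.
  by apply/eqP; rewrite eq_le; apply/andP; split; apply: ae_le_Rintegral => //;
    apply: filterS ae1 => x ->.
have [piT [piTE costT]] := exists_graph_plan mu mT.
have planT : transport_plan mu (empirical y) piT.
  move=> A mA; rewrite !piTE; [|exact: measurableX..]; split.
    by congr (mu _); apply/seteqP; split => x //= -[].
  by rewrite -muT//; congr (mu _); apply/seteqP; split => x //= -[].
have := pimin _ planT; rewrite costT (transport_cost_graph mS piE) => leST.
pose a x := sqnorm (x - S x); pose b x := sqnorm (x - T x).
have ma : measurable_fun setT a by exact: measurable_sqdist.
have mb : measurable_fun setT b by exact: measurable_sqdist.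
have ib : mu.-integrable setT (EFin \o b).
  apply: (@le_integrable _ _ _ mu _ measurableT _ (EFin \o (fun x => \sum_i c i x))).
  - exact/measurable_EFinP.
  - move=> x _ /=; rewrite lee_fin !ger0_norm ?sqnorm_ge0//; last first.
      by apply: sumr_ge0 => i _; exact: sqnorm_ge0.
    have [i] := Tin x; rewrite /b => ->; rewrite (bigD1 i)//= lerDl.
    by apply: sumr_ge0 => j _; exact: sqnorm_ge0.
  - exact: integrable_Rsum.
have ia : mu.-integrable setT (EFin \o a).
  apply/integrableP; split; first exact/measurable_EFinP.
  rewrite (eq_integral (fun x => (a x)%:E)) => [|x _].
    by apply: le_lt_trans leST _; exact: integrable_lty ib.
  by rewrite /= ger0_norm// sqnorm_ge0.
pose u i := if 0 < p i then w i else 0.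
pose psi (U : 'rV[R]_d -> 'rV[R]_d) x := \sum_i u i * (U x == y i)%:R.
have meq (U : 'rV[R]_d -> 'rV[R]_d) i : measurable_fun setT U -> measurable_fun setT (fun x => U x == y i).
  by move=> mU; exact: measurable_fun_eq_rV.
have ipsi U : measurable_fun setT U -> mu.-integrable setT (EFin \o psi U).
  by move=> mU; apply: integrable_step => i; exact: meq.
have psiST : \int[mu]_x psi S x = \int[mu]_x psi T x.
  rewrite !Rintegral_step; [|by move=> i; exact: meq..].
  apply: eq_bigr => i _; congr (_ * fine _).
  have my : measurable [set z | z == y i].
    apply: measurable_set_bool.
    by apply: (@measurable_fun_eq_rV _ _ _ _ idfun (cst (y i))); [exact: measurable_id|exact: measurable_cst].
  exact: etrans (muS _ my) (esym (muT _ my)).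
have psiE U x j : 0 < p j -> U x = y j -> psi U x = w j.
  move=> pj Ux; rewrite /psi (bigD1 j)//= Ux eqxx mulr1 /u pj big1 ?addr0// => i ij.
  case: ifPn => [p_i|]; last by rewrite mul0r.
  case: eqP => [/(atom_weight_inj n_gt0 pj p_i) ji|]; last by rewrite mulr0.
  by rewrite ji eqxx in ij.
have Sin : {ae mu, forall x, exists j, S x = y j}.
  pose N := [set z | [forall j, z != y j]].
  have mN : measurable N.
    apply/measurable_set_bool/measurable_fun_forall => j.
    apply: measurableT_comp => //.
    by apply: (@measurable_fun_eq_rV _ _ _ _ idfun (cst (y j))); [exact: measurable_id|exact: measurable_cst].
  exists (S @^-1` N); split.
  - by rewrite -[X in measurable X]setTI; exact: mS.
  - rewrite muS// empiricalE big1// => i _.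
    case: asboolP => [/forallP/(_ i)|]; last by rewrite mul0r.
    by rewrite eqxx.
  - move=> x /= /forallNP Sx; apply/forallP => j; apply/eqP; exact: Sx.
(* The excess of S over T at x is the gap between their indices j and i. *)
have key x : (exists j, S x = y j) ->
   (exists i, forall j, cell c p w 0 j x = (j == i)) ->
   exists i j, [/\ forall l, cell c p w 0 l x = (l == i), 0 < p i, 0 < p j,
     S x = y j & (a x - psi S x) - (b x - psi T x) =
                 (c j x - w j) - (c i x - w i)].
  move=> [j0 Sx0] [i xi]; have [j pj yj] := atom_weight_exists R y n_gt0 j0.
  have Sx : S x = y j by rewrite Sx0.
  have pi0 : 0 < p i by have := xi i; rewrite eqxx => /cellP[].
  exists i, j; split=> //.
  by rewrite (psiE _ _ _ pj Sx) (psiE _ _ _ pi0 (TE _ _ xi)) /a /b Sx (TE _ _ xi).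
have D0 : {ae mu, forall x, (a x - psi S x) - (b x - psi T x) = 0}.
  apply: ae_eq0_Rintegral.
  - by apply: integrable_RB; apply: integrable_RB => //; exact: ipsi.
  - apply: filterS2 Sin uniq => x h1 h2; have [i [j [xi p_i pj _ ->]]] := key x h1 h2.
    rewrite subr_ge0; have := xi i; rewrite eqxx => /cellP[_ /(_ j pj)].
    by rewrite addr0.
  - rewrite RintegralB//; [|by apply: integrable_RB => //; exact: ipsi..].
    rewrite !RintegralB//; [|exact: ipsi..].
    rewrite psiST opprB addrA subrK subr_le0.
    rewrite -lee_fin /Rintegral !fineK//; exact: integrable_fin_num.
apply: filterS3 Sin uniq D0 => x h1 h2; have [i [j [xi p_i pj Sx ->]]] := key x h1 h2.
move=> ji i'; rewrite xi => /eqP ->; rewrite Sx; congr y.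
apply/eqP; rewrite -xi; apply/cellP; split=> // l pl.
have := xi i; rewrite eqxx => /cellP[_ /(_ l pl)]; lra.
Qed.

End optimal_map_on_cells.

(** * Measurable selection *)

Section measurable_kernel_mass.
Context d1 d2 (Th : measurableType d1) (E : measurableType d2) (R : realType).
Variable kap : Th -> probability E R.
Hypothesis mkap : forall A, measurable A -> measurable_fun setT (fun th => kap th A).

(** The measurability proof is an argument so that the kernel structure can be
attached to this function. *)
Definition kernel_of (_ : forall A, measurable A ->
    measurable_fun setT (fun th => kap th A)) : Th -> {measure set E -> \bar R} :=
  fun th => kap th.
Local Notation k := (kernel_of mkap).

HB.instance Definition _ := isKernel.Build _ _ _ _ _ k mkap.

Let k1 th : k th setT = 1%E. Proof. exact: probability_setT. Qed.
HB.instance Definition _ := Kernel_isProbability.Build _ _ _ _ _ k k1.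

Lemma measurable_kernel_section (b : Th * E -> bool) : measurable_fun setT b ->
  measurable_fun setT (fun th => fine (kap th [set x | b (th, x)])).
Proof.
move=> /measurable_set_bool mb.
have mk : measurable_fun setT (fun th => k th (xsection [set z | b z] th)).
  by apply: measurable_fun_xsection_finite_kernel; rewrite inE.
apply: measurableT_comp => //; move: mk; congr (measurable_fun _ _).
apply/funext => th; congr (kap th _).
by apply/seteqP; split => x; rewrite /xsection/= inE.
Qed.

End measurable_kernel_mass.

Section selection.
Context d1 (Th : measurableType d1) (R : realType) (d n : nat).
Variable kap : Th -> probability 'rV[R]_d R.
Variable y : 'I_n -> Th -> 'rV[R]_d.
Hypothesis n_gt0 : (0 < n)%N.
Hypothesis mkap : forall A, measurable A -> measurable_fun setT (fun th => kap th A).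
Hypothesis my : forall i, measurable_fun setT (y i).

Local Notation c th := (atom_cost (y ^~ th)).
Local Notation p th := (atom_weight R (y ^~ th)).

Let measurable_boolR d' (T : measurableType d') (b : T -> bool) :
  measurable_fun setT b -> measurable_fun setT (fun x => (b x)%:R : R).
Proof.
move=> mb; rewrite (_ : (fun x => _) = fun x => if b x then 1 else 0).
  exact: measurable_fun_ifT.
by apply/funext => x; case: (b x).
Qed.

Lemma measurable_atom_weight i : measurable_fun setT (fun th => p th i).
Proof.
apply: measurable_funM.
  apply: measurable_boolR; apply: measurable_fun_forall => j.
  apply: measurable_fun_implyb => //; apply: measurableT_comp => //.
  exact: measurable_fun_eq_rV.
apply: measurable_funM => //; apply: measurable_sum => j.
by apply: measurable_boolR; exact: measurable_fun_eq_rV.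
Qed.

Lemma measurable_param_cell (w : 'I_n -> R) i :
  measurable_fun setT
    (fun z : Th * 'rV[R]_d => cell (c z.1) (p z.1) w 0 i z.2).
Proof.
have mp j : measurable_fun setT (fun z : Th * 'rV[R]_d => 0 < p z.1 j).
  apply: measurable_fun_ltr => //.
  exact: measurableT_comp (measurable_atom_weight j) measurable_fst.
have mc j : measurable_fun setT (fun z : Th * 'rV[R]_d => c z.1 j z.2).
  by apply: measurable_sqdist => //; exact: measurableT_comp (my j) measurable_fst.
apply: measurable_and => //; apply: measurable_fun_forall => j.
apply: measurable_fun_implyb => //; apply: measurable_fun_ler.
  exact: measurable_funB.
by apply: measurable_funD => //; exact: measurable_funB.
Qed.

(** An enumeration of the rational potentials. *)
(** An enumeration of all vectors of rational potentials; the indices which do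
not encode a vector give the null vector. *)
Definition rational_potential (m : nat) : 'I_n -> R :=
  fun i => ratr (odflt [ffun=> 0] (unpickle m : option {ffun 'I_n -> rat}) i).

Definition almost_balanced (k m : nat) (th : Th) : bool :=
  [forall i, `|cellmass (kap th) (c th) (p th) (rational_potential m) 0 i - p th i| *
    (1 + `|rational_potential m i|) <= (2 ^ k.+1)%:R^-1].

Lemma measurable_almost_balanced k m : measurable_fun setT (almost_balanced k m).
Proof.
apply: measurable_fun_forall => i; apply: measurable_fun_ler => //.
apply: measurable_funM => //; apply: measurableT_comp => //.
apply: measurable_funB; last exact: measurable_atom_weight.
exact: measurable_kernel_section (measurable_param_cell _ i).
Qed.

(** The first almost balanced vector of potentials for the tolerance 2^-(k+1). *)
Definition selected (k m : nat) (th : Th) : bool :=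
  almost_balanced k m th && [forall l : 'I_m, ~~ almost_balanced k l th].

Lemma measurable_selected k m : measurable_fun setT (selected k m).
Proof.
apply: measurable_and; first exact: measurable_almost_balanced.
apply: measurable_fun_forall => l; apply: measurableT_comp => //.
exact: measurable_almost_balanced.
Qed.

(** The points which lie in the cell i of the selected potentials for infinitely
many tolerances. *)
Definition limit_cell (i : 'I_n) : set (Th * 'rV[R]_d) :=
  \bigcap_K \bigcup_(k in [set k | (K <= k)%N]) \bigcup_m
    [set z | selected k m z.1 && cell (c z.1) (p z.1) (rational_potential m) 0 i z.2].

Lemma measurable_limit_cell i : measurable (limit_cell i).
Proof.
apply: bigcapT_measurable => K; apply: bigcup_measurable => k _.
apply: bigcupT_measurable => m; apply/measurable_set_bool/measurable_and.
  exact: measurableT_comp (measurable_selected k m) measurable_fst.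
exact: measurable_param_cell.
Qed.

Definition selection : Th * 'rV[R]_d -> 'rV[R]_d :=
  first_match (fun i z => `[< limit_cell i z >]) (fun i z => y i z.1) 0 (enum 'I_n).

Lemma measurable_selection : measurable_fun setT selection.
Proof.
apply: measurable_first_match => i.
  apply: (measurable_fun_bool true); rewrite setTI.
  rewrite [X in measurable X](_ : _ = limit_cell i); last first.
    by apply/seteqP; split => z /= /asboolP.
  exact: measurable_limit_cell.
exact: measurableT_comp (my i) measurable_fst.
Qed.

(** By [stable_cells], almost every x is eventually in the approximate cells of
the same single index as for the exact potentials, so it belongs to exactly one
of the limit cells, and [optimal_map_on_cells] identifies S there. *)
Lemma selection_optimal th S : has_density (kap th) ->
  (\int[kap th]_x (sqnorm x)%:E < +oo)%E ->
  optimal_transport_map (kap th) (empirical (y ^~ th)) S ->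
  {ae kap th, forall x, selection (th, x) = S x}.
Proof.
move=> dens mom optS.
have ci i : (kap th).-integrable setT (EFin \o c th i) by exact: integrable_sqdist.
have mc i : measurable_fun setT (c th i) by exact: measurable_Rint (ci i).
have p_pos := atoms_p_pos (y ^~ th) n_gt0.
have ties := atoms_no_ties n_gt0 dens (y := y ^~ th).
have [w wp] := exists_potentials ci (@atom_weight_ge0 R _ _ (y ^~ th))
  (sum_atom_weight1 R (y ^~ th) n_gt0) ties.
have /choice[m mP] k : exists m, selected k m th.
  have e0 : 0 < (2 ^ k.+1)%:R^-1 :> R by rewrite invr_gt0 ltr0n expn_gt0.
  have [q qP] := rational_balanced mc p_pos ties e0 wp.
  have ex : exists m, almost_balanced k m th.
    by exists (pickle q); apply/forallP => i; rewrite /rational_potential pickleK; exact: qP.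
  case: (ex_minnP ex) => m mb mmin; exists m; rewrite /selected mb/=.
  apply/forallP => l; apply/negP => /mmin; by rewrite leqNgt ltn_ord.
have m_uniq k l : selected k l th -> l = m k.
  move=> /andP[lb /forallP lmin]; have /andP[kb /forallP kmin] := mP k.
  apply/eqP; rewrite eqn_leq; apply/andP; split; rewrite leqNgt; apply/negP => lt.
    by have := lmin (Ordinal lt); rewrite kb.
  by have := kmin (Ordinal lt); rewrite lb.
have stab := stable_cells mc p_pos ties wp
  (fun k => forallP (andP (mP k)).1).
have onS := optimal_map_on_cells n_gt0 dens mom wp optS.
apply: filterS3 (ae_unique_cell mc p_pos ties w) stab onS => x [i xi] [K _ stabx] Sx.
rewrite (Sx i); last by rewrite xi eqxx.
rewrite /selection (@first_matchE _ _ _ _ _ _ _ _ _ _ i) ?mem_enum//.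
  apply/asboolP => K' _; exists (maxn K K'); first by rewrite /= leq_maxr.
  exists (m (maxn K K')) => //=; rewrite mP/=.
  have [j xj] := exists_cell (c th) (rational_potential (m (maxn K K'))) x p_pos.
  have := stabx _ (leq_maxl K K') j xj; rewrite xi => /eqP ji.
  by rewrite -ji.
move=> j /asboolP/(_ K Logic.I)[k /= Kk [l _ /= /andP[/m_uniq -> xj]]].
by have := stabx _ Kk j xj; rewrite xi => /eqP.
Qed.

End selection.

(** * Predictable processes *)

(** The integral of a nonnegative function is a supremum over the simple functions
below it, hence monotone whether or not the functions are measurable; this is
applied to a supremum over an uncountable set of times. *)
Lemma ge0_le_integral_nonmeasurable d (T : measurableType d) (R : realType)
    (mu : {measure set T -> \bar R}) (f g : T -> \bar R) :
  (forall x, (0 <= f x)%E) -> (forall x, (f x <= g x)%E) ->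
  (\int[mu]_x f x <= \int[mu]_x g x)%E.
Proof.
move=> f0 fg; rewrite !ge0_integralTE//; last by move=> x; exact: le_trans (fg x).
apply: ge_ereal_sup => _ [h hf <-]; apply: ereal_sup_ubound.
by exists h => // x; exact: le_trans (fg x).
Qed.

Section moments.
Context {d0 : measure_display} {Omega : measurableType d0} {R : realType}.
Variables (Pr : probability Omega R) (F : R -> set (set Omega)).
Context {d : nat}.
Variable P : R -> probability 'rV[R]_d R.

Lemma nonlinear_process_moment sigma b W X (t : R) : 0 <= t ->
  nonlinear_process Pr F P sigma b W X ->
  (\int[P t]_x (sqnorm x)%:E < +oo)%E.
Proof.
move=> t0 np; have mX := np_measurable np t0.
pose Xt : {mfun Omega >-> 'rV[R]_d} :=
  HB.pack (X t) (isMeasurableFun.Build _ _ _ _ _ mX).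
apply: le_lt_trans (np_moment np t0).
rewrite (_ : (\int[P t]_x _)%E = \int[distribution Pr Xt]_x (sqnorm x)%:E)%E; last first.
  apply: eq_measure_integral => A mA _; exact: esym (np_law np t0 mA).
rewrite ge0_integral_pushforward//; last 2 first.
- by apply/measurable_EFinP; exact: measurable_sqnorm.
- by move=> x _; rewrite lee_fin sqnorm_ge0.
rewrite preimage_setT; apply: ge0_le_integral_nonmeasurable => w /=.
  by rewrite lee_fin sqnorm_ge0.
by apply: ereal_sup_ubound; exists t => //=; rewrite in_itv/= t0 lexx.
Qed.

End moments.

Section predictable_space.
Context {d0 : measure_display} {Omega : measurableType d0} {R : realType}.
Variables (F : R -> set (set Omega)) (T : R).

Local Notation D := (`[0, T] `*` setT : set (R * Omega)).

(** The events of R x Omega whose trace on [0, T] x Omega is predictable. They form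
a sigma-algebra on the whole product, and a function is measurable for it as soon as it is
so on [0, T]. *)
Definition predictable_events : set (set (R * Omega)) :=
  [set E | predictable F T (D `&` E)].

Lemma sigma_algebra_predictable_events : sigma_algebra setT predictable_events.
Proof.
have := sigma_algebra_image id (smallest_sigma_algebra D
  [set E | exists (Y : R -> Omega -> R) (B : set R),
       [/\ forall w, {within `[0, T], continuous (Y^~ w)},
           adapted F `[0, T] Y, measurable B &
           E = (`[0, T] `*` setT) `&` [set z | B (Y z.1 z.2)]]]).
exact.
Qed.

Definition predictable_space := g_sigma_algebraType predictable_events.
HB.instance Definition _ := Measurable.on predictable_space.

Lemma measurable_predictable_space (E : set predictable_space) :
  measurable E <-> predictable F T (D `&` E).
Proof.
rewrite /measurable/= sigma_algebra_id//.
exact: sigma_algebra_predictable_events.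
Qed.

Lemma measurable_continuous_adapted (Y : R -> Omega -> R) :
  (forall w, {within `[0, T], continuous (Y^~ w)}) -> adapted F `[0, T] Y ->
  measurable_fun setT (fun z : predictable_space => Y z.1 z.2).
Proof.
move=> cY aY _ B mB; rewrite setTI; apply/measurable_predictable_space.
by apply: sub_sigma_algebra; exists Y, B.
Qed.

(** It is enough to look at rectangles, whose traces are rectangles with a
predictable side. *)
Lemma predictable_borel_trace d (Z : set (predictable_space * 'rV[R]_d)) :
  measurable Z -> predictable_borel F T ((D `*` setT) `&` Z).
Proof.
rewrite measurable_prod_measurableType; move: Z.
apply: (smallest_sub (sigma_algebra_image id (smallest_sigma_algebra (D `*` setT)
  [set E : set (R * Omega * 'rV[R]_d) | exists A B,
     [/\ predictable F T A, measurable B & E = A `*` B]]))).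
move=> _ [A /measurable_predictable_space mA [B mB <-]].
apply: sub_sigma_algebra; exists (D `&` A), B; split=> //.
by rewrite -setXI setTI.
Qed.

Lemma measurable_predictable_time :
  (forall t, F t set0 /\ F t setT) ->
  measurable_fun setT (fun z : predictable_space => z.1 : R).
Proof.
move=> F0T; apply: (measurable_continuous_adapted (Y := fun t _ => t)).
  by move=> w; apply: continuous_subspaceT => x; exact: cvg_id.
move=> t B _ _ /=; have [F0 FT] := F0T t.
have [Bt|Bt] := pselect (B t).
  by rewrite (_ : _ @^-1` _ = setT)//; apply/seteqP; split.
by rewrite (_ : _ @^-1` _ = set0)//; apply/seteqP; split.
Qed.

End predictable_space.

Lemma noise_filtration_trivial d0 (Omega : measurableType d0) (R : realType)
    (Pr : probability Omega R) (d n : nat) W X0 t :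
  @noise_filtration _ Omega R Pr d n W X0 t set0 /\
  @noise_filtration _ Omega R Pr d n W X0 t setT.
Proof.
split=> u _; have [s0 sC _] := smallest_sigma_algebra setT
  (noise_events W X0 u `|` null_events Pr) => //.
by move: (sC _ s0); rewrite setD0.
Qed.

Theorem theorem1p2 (R : realType) (d n : nat) (T : R)
    (hT : 0 < T) (hn : (1 <= n)%N)
    (sigma : 'rV[R]_d -> 'M[R]_d) (b : 'rV[R]_d -> 'rV[R]_d)
    (sigma_lip : lipschitz sigma) (sigma_growth : linear_growth sigma)
    (b_lip : lipschitz b) (b_growth : linear_growth b)
    (d0 : measure_display) (Omega : measurableType d0)
    (Pr : probability Omega R)
    (P : R -> probability 'rV[R]_d R)
    (P0_moment : (\int[P 0%R]_x (sqnorm x)%:E < +oo)%E)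
    (W : 'I_n -> set (R * 'rV[R]_d) -> Omega -> 'rV[R]_d)
    (X : 'I_n -> R -> Omega -> 'rV[R]_d)
    (W_noise : forall i, white_noise Pr P (W i))
    (W_X0_independent : independent_sigma_fields Pr
       (fun j : 'I_n + 'I_n => match j with
          | inl i => noise_sigma_field P (W i)
          | inr i => preimage_set_system setT (X i 0) measurable
          end))
    (X_solution : forall i,
       nonlinear_process Pr (noise_filtration Pr W (fun j => X j 0)) P
         sigma b (W i) (X i))
    (P_density : forall t, 0 < t -> has_density (P t))
    (Tmap : R -> Omega -> 'rV[R]_d -> 'rV[R]_d)
    (Tmap_optimal : forall t w, 0 < t <= T ->
       optimal_transport_map (P t) (empirical (fun i => X i t w)) (Tmap t w)) :
  exists Tn : R -> Omega -> 'rV[R]_d -> 'rV[R]_d,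
    predictable_borel_measurable (noise_filtration Pr W (fun j => X j 0)) T Tn /\
    {ae (lebesgue_measure \x Pr)%E, forall z : R * Omega, 0 <= z.1 <= T ->
       {ae P z.1, forall x, Tn z.1 z.2 x = Tmap z.1 z.2 x}}.
Proof.
pose F := noise_filtration Pr W (fun j => X j 0).
pose Th : measurableType _ := predictable_space F T.
have i0 : 'I_n by exact: Ordinal hn.
have mtime := @measurable_predictable_time _ _ _ F T
  (noise_filtration_trivial Pr W (fun j => X j 0)).
have mP A : measurable A -> measurable_fun setT (fun z : Th => P z.1 A).
  move=> mA _ B mB; rewrite setTI; apply/measurable_predictable_space.
  have mC := wn_family (W_noise i0) mA (measurable_itv _) mB.
  rewrite [X in predictable _ _ X](_ : _ = (`[0, T] `*` setT) `&`
      ((fun z : Th => z.1) @^-1` (`[0, +oo[ `&` P^~ A @^-1` B))).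
    by apply/measurable_predictable_space; rewrite -[X in measurable X]setTI; exact: mtime.
  apply/seteqP; split => -[t w] /= [[/= tT _] tB]; split=> //; last by case: tB.
  by split=> //; move: tT; rewrite !in_itv/= => /andP[->].
have mX i : measurable_fun setT (fun z : Th => X i z.1 z.2).
  apply: measurable_fun_rV => j.
  apply: (measurable_continuous_adapted (Y := fun t w => X i t w ord0 j)).
    move=> w; have [_ /(_ w) cX _ _ _ _] := X_solution i.
    have sub : (`[0, T]%classic : set R) `<=` `[0, +oo[%classic.
      by move=> t; rewrite /= !in_itv/= => /andP[->].
    have {}cX := continuous_subspaceW sub cX.
    move=> t; exact: (continuous_comp (cX t) (@coord_continuous R _ _ ord0 j _)).
  move=> t B; rewrite /= in_itv/= => /andP[t0 tT] mB.
  have := np_adapted (X_solution i) (t := t)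
    (B := (fun M : 'rV[R]_d => M ord0 j) @^-1` B).
  apply; first by rewrite /= in_itv/= t0.
  by rewrite -[X in measurable X]setTI; exact: measurable_coord.
pose Q (z : Th) := P z.1.
pose G := selection Q (fun i (z : Th) => X i z.1 z.2).
exists (fun t w x => G ((t, w) : Th, x)); split.
  move=> B mB.
  have mG : measurable (G @^-1` B).
    by rewrite -[X in measurable X]setTI; exact: measurable_selection.
  rewrite (_ : [set z | _] = (G @^-1` B : set (R * Omega * 'rV[R]_d))).
    exact: predictable_borel_trace.
  by apply/seteqP; split=> -[[t w] x].
(* The exceptional set is the initial time. *)
exists ([set 0] `*` setT); split.
- exact: measurableX.
- by rewrite product_measure1E//= [X in (X * _)%E]lebesgue_measure_set1 mul0e.
- move=> [t w] /= /not_implyP[/= /andP[t0 tT] nG]; split=> //=.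
  apply: contrapT => /eqP tn0; apply: nG.
  have {}t0 : 0 < t by rewrite lt_neqAle eq_sym tn0 t0.
  apply: (@selection_optimal _ Th R d n Q (fun i z => X i z.1 z.2) hn
    (t, w) (Tmap t w)) => //.
  + exact: P_density.
  + exact: nonlinear_process_moment (ltW t0) (X_solution i0).
  + by apply: Tmap_optimal; rewrite t0 tT.
Qed.
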